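(* Fix an integer $r\geq 2$ and let $G$ be any finitely presented abelian group. Then for any integer $k$ with $1\leq k\leq r-2$ there exist an $n$ and a complex $Y\in\mathcal{M}_r(n)$ with $H_k(Y;\mathbb{Z})\cong G$.
   Context: A maximal simplex (facet) of a simplicial complex $X$ is a simplex not properly contained in another simplex of $X$; by convention only simplexes of dimension at least $1$ are considered maximal simplexes (isolated vertices are not). $X$ is pure $r$-dimensional if it has dimension $r$ and all its maximal simplexes have dimension $r$. Removing a facet $\sigma$ from $X$ means passing to the simplicial complex $X'$ with the same vertex set as $X$ and whose set of maximal simplexes (of dimension $\ge 1$) is that of $X$ with $\sigma$ deleted. An $r$-dimensional minimal connected cover on $[n]$ is a pure $r$-dimensional simplicial complex $Y$ with vertex set $[n]=\{1,\dots,n\}$ that is connected and such that the removal of any facet disconnects $Y$. $\mathcal{M}_r(n)$ denotes the set of all $r$-dimensional minimal connected covers on $[n]$. *)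

(* Defs.v *)
From HB Require Import structures.
From mathcomp Require Import all_boot all_order all_algebra.
From mathcomp Require Import boolp.

Set Implicit Arguments.
Unset Strict Implicit.
Unset Printing Implicit Defensive.

Import GRing.Theory Num.Theory.
Local Open Scope ring_scope.

(* The vertex set [n] is rendered by 'I_n, so {1, ..., n} is shifted to
   {0, ..., n-1}.  The empty simplex is excluded, so that the homology below
   is the unreduced one; a simplex s has dimension #|s| - 1. *)
Record simplicial_complex (n : nat) := Complex {
  simplices :> {set {set 'I_n}};
  simplices_neq0 : set0 \notin simplices;
  simplices1 : forall v : 'I_n, [set v] \in simplices;
  simplicesS : forall s t : {set 'I_n},
    s \in simplices -> t \subset s -> t != set0 -> t \in simplices }.

Section Covers.
Variable n : nat.
Implicit Types (X : simplicial_complex n) (s t : {set 'I_n}).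

(* The bound 1 < #|s| says that isolated vertices are not facets. *)
Definition facets X : {set {set 'I_n}} :=
  [set s in X | (1 < #|s|)%N & ~~ [exists t : {set 'I_n} in X, s \proper t]].

Section Removal.
Variables (X : simplicial_complex n) (s : {set 'I_n}).

Definition remove_simplices : {set {set 'I_n}} :=
  [set t in X | (#|t| == 1%N) 
    || [exists u : {set 'I_n} in facets X :\ s, t \subset u]].

Fact remove_neq0 : set0 \notin remove_simplices.
Proof. by rewrite inE (negPf (simplices_neq0 X)). Qed.

Fact remove1 (v : 'I_n) : [set v] \in remove_simplices.
Proof. by rewrite inE simplices1 cards1. Qed.

Fact removeS (t u : {set 'I_n}) :
  t \in remove_simplices -> u \subset t -> u != set0 -> u \in remove_simplices.
Proof.
rewrite !inE => /andP[tX t_or] ut u0; rewrite (simplicesS tX ut u0) /=.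
case/orP: t_or => [t1|/exists_inP[w wF tw]].
  by rewrite eqn_leq card_gt0 u0 -(eqP t1) subset_leq_card.
by apply/orP; right; apply/exists_inP; exists w; last exact: subset_trans tw.
Qed.

Definition remove_facet : simplicial_complex n := Complex remove_neq0 remove1 removeS.

Lemma facets_remove : s \in facets X -> facets remove_facet = facets X :\ s.
Proof.
move=> sF; apply/setP=> t; apply/idP/idP; last first.
  move=> tF; have := tF; rewrite in_setD1 => /andP[_].
  rewrite !inE => /and3P[tX t1 tmax]; rewrite tX t1 /=; apply/andP; split.
    by apply/orP; right; apply/exists_inP; exists t.
  apply: contra tmax => /exists_inP[u].
  by rewrite inE => /andP[uX _] tu; apply/exists_inP; exists u.
rewrite inE => /and3P[/=]; rewrite inE => /andP[tX].
case/orP=> [/eqP->//|/exists_inP[u uF tu]] t1 tmax.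
suff -> : t = u by [].
apply/eqP; apply: contraR tmax => tNu; apply/exists_inP; exists u.
  rewrite inE; apply/andP; split; last by apply/orP; right; apply/exists_inP; exists u.
  by move: uF; rewrite !inE => /andP[_ /andP[]].
by rewrite properEneq tNu tu.
Qed.

End Removal.

(* The predecessor is truncated: for n = 0 the only complex is empty and gets
   dimension 0 rather than -1. *)
Definition dim X : nat := (\max_(s in X) #|s|).-1.

Definition pure r X : bool :=
  (dim X == r) && [forall s : {set 'I_n} in facets X, #|s| == r.+1].

Definition adjacent X : rel 'I_n := fun u v => [set u; v] \in X.

Definition connected X : bool :=
  [forall u, forall v, connect (adjacent X) u v].

Definition minimal_connected_cover r X : bool :=
  [&& pure r X, connected X
    & [forall s : {set 'I_n} in facets X, ~~ connected (remove_facet X s)]].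

End Covers.

Section Homology.
Variables (n : nat) (X : simplicial_complex n).

Definition simplex (k : nat) :=
  {s : {set 'I_n} | (s \in X) && (#|s| == k.+1)}.

(* Each simplex is oriented by the order of its vertices. *)
Definition chain (k : nat) := {ffun simplex k -> int}.

Definition vertex_sign (s : {set 'I_n}) (i : 'I_n) : int :=
  (-1) ^+ #|[set j in s | (j < i)%N]|.

(* The coefficient of t in the boundary of s; the sum has at most one term. *)
Definition incidence (s t : {set 'I_n}) : int :=
  \sum_(i in s | t == s :\ i) vertex_sign s i.

(* For k = 0 the target is again chain 0, and the boundary is 0, because all
   the incidence numbers between vertices vanish. *)
Definition boundary (k : nat) (c : chain k) : chain k.-1 :=
  [ffun t => \sum_s c s * incidence (val s) (val t)].

Fact boundary_is_zmod_morphism k : zmod_morphism (@boundary k).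
Proof.
move=> c d; apply/ffunP=> t; rewrite !ffunE -sumrB; apply: eq_bigr => s _.
by rewrite !ffunE mulrBl.
Qed.

HB.instance Definition _ k := GRing.isZmodMorphism.Build (chain k) (chain k.-1)
  (@boundary k) (@boundary_is_zmod_morphism k).

Lemma boundary0 (c : chain 0) : boundary c = 0.
Proof.
apply/ffunP=> t; rewrite !ffunE big1 // => s _.
rewrite /incidence big1 ?mulr0 // => i /andP[is_s /eqP ts].
have /andP[_ /eqP s1] := valP s; have /andP[_ /eqP] := valP t.
by rewrite ts; move: s1; rewrite (cardsD1 i) is_s add1n => -[->].
Qed.

Lemma vertex_sign_swap (s : {set 'I_n}) (i j : 'I_n) :
  i \in s -> j \in s -> i != j ->
  vertex_sign s i * vertex_sign (s :\ i) j =
  - (vertex_sign s j * vertex_sign (s :\ j) i).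
Proof.
have main (a b : 'I_n) : a \in s -> b \in s -> (a < b)%N ->
  vertex_sign s a * vertex_sign (s :\ a) b =
  - (vertex_sign s b * vertex_sign (s :\ b) a).
  move=> sa sb ab; rewrite /vertex_sign.
  have -> : [set x in s :\ b | (x < a)%N] = [set x in s | (x < a)%N].
    apply/setP=> x; rewrite !inE; case: eqVneq => //= ->.
    by rewrite (ltnNge b a) (ltnW ab) andbF.
  have -> : [set x in s :\ a | (x < b)%N] = [set x in s | (x < b)%N] :\ a.
    by apply/setP=> x; rewrite !inE andbA.
  rewrite [X in _ = - ((-1) ^+ X * _)](cardsD1 a) inE sa ab /=.
  by rewrite exprS mulN1r mulNr opprK mulrC.
move=> si sj; rewrite neq_ltn => /orP[] lt_ij; first exact: main.
by rewrite (main j i) ?opprK.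
Qed.

Lemma boundaryK k (c : chain k) : boundary (boundary c) = 0.
Proof.
case: k c => [|k] c; first by rewrite boundary0 raddf0.
apply/ffunP=> t; rewrite !ffunE.
under eq_bigr => u _ do rewrite ffunE mulr_suml.
rewrite exchange_big big1 //= => s _.
under eq_bigr => u _ do rewrite -mulrA.
rewrite -mulr_sumr.
suff -> : \sum_(u : simplex k)
    incidence (val s) (val u) * incidence (val u) (val t) = 0 by rewrite mulr0.
have /andP[sX /eqP s_card] := valP s.
pose F i j := vertex_sign (val s) i * vertex_sign (val s :\ i) j
  *+ ((i \in val s) && ((j \in val s) && ((i != j)
      && (val t == val s :\ i :\ j)))).
have -> : \sum_(u : simplex k)
    incidence (val s) (val u) * incidence (val u) (val t)
    = \sum_i \sum_j F i j.
  rewrite /incidence.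
  under eq_bigr => u _ do rewrite mulr_suml.
  under eq_bigr => u _ do rewrite big_mkcond /=.
  rewrite exchange_big /=; apply: eq_bigr => i _.
  have [si|sNi] := boolP (i \in val s); last first.
    rewrite !big1 //= => j _; first by rewrite /F (negPf sNi).
  have uP : (val s :\ i \in X) && (#|val s :\ i| == k.+1).
    have cu : #|val s :\ i| = k.+1.
      by move: s_card; rewrite (cardsD1 i) si add1n => -[->].
    by rewrite cu eqxx andbT (simplicesS sX) ?subD1set // -card_gt0 cu.
  rewrite (bigD1 (Sub (val s :\ i) uP : simplex k)) //= eqxx [X in _ + X]big1 ?addr0; last first.
    by move=> u; rewrite -val_eqE /= => /negPf->.
  rewrite mulr_sumr big_mkcond /=; apply: eq_bigr => j _.
  rewrite /F si !inE (eq_sym i) /=.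
  by case: (j != i); case: (j \in sval s); case: (_ == _).
have F_anti i j : F i j = - F j i.
  rewrite /F; have [->|ij] := eqVneq i j; first by rewrite !andbF !mulr0n oppr0.
  have -> : val s :\ i :\ j = val s :\ j :\ i.
    by rewrite !setDDl setUC.
  have [si|] := boolP (i \in val s);
    have [sj|] := boolP (j \in val s); rewrite ?mulr0n ?oppr0 //=.
  by rewrite (vertex_sign_swap si sj ij) mulNrn.
set S := \sum_i _; suff: S *+ 2 == 0 by rewrite mulrn_eq0 /= => /eqP.
rewrite mulr2n {2}/S exchange_big -big_split /=; apply/eqP; apply: big1 => i _.
by rewrite -big_split /=; apply: big1 => j _; rewrite F_anti addNr.
Qed.

Definition cycle_pred (k : nat) : {pred chain k} :=
  fun c => boundary c == 0.

Fact cycle_pred_zmod_closed k : zmod_closed (@cycle_pred k).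
Proof.
split=> [|c d]; rewrite !unfold_in ?raddf0 // => /eqP c0 /eqP d0.
by rewrite raddfB /= c0 d0 subr0.
Qed.

HB.instance Definition _ k := GRing.isZmodClosed.Build (chain k)
  (@cycle_pred k) (cycle_pred_zmod_closed k).

Record kcycle (k : nat) := KCycle {
  chain_of_cycle :> chain k;
  _ : chain_of_cycle \in @cycle_pred k }.

HB.instance Definition _ k := [isSub for @chain_of_cycle k].
HB.instance Definition _ k := [Choice of kcycle k by <:].
HB.instance Definition _ k := [SubChoice_isSubZmodule of kcycle k by <:].

(* By boundaryK, every boundary is the chain of some kcycle, so the quotient by
   boundary_pred is indeed Z_k / B_k. *)
Definition boundary_pred (k : nat) : {pred kcycle k} :=
  fun z => `[< exists c : chain k.+1, chain_of_cycle z = boundary c >].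

Fact boundary_pred_zmod_closed k : zmod_closed (@boundary_pred k).
Proof.
split=> [|y z]; rewrite !unfold_in.
  by apply/asboolP; exists 0; rewrite raddf0.
move=> /asboolP[c yc] /asboolP[d zd]; apply/asboolP; exists (c - d).
by rewrite raddfB /= -yc -zd.
Qed.

HB.instance Definition _ k := GRing.isZmodClosed.Build (kcycle k)
  (@boundary_pred k) (boundary_pred_zmod_closed k).

Definition homology (k : nat) := Quotient.quot (@boundary_pred k).

HB.instance Definition _ k := GRing.Zmodule.on (homology k).

End Homology.

Arguments homology {n} X k.

(* G is isomorphic, through the map induced by f, to the quotient of Z^q (the
   generators) by the subgroup spanned by the p rows of A (the relations). *)
Definition finitely_presented (G : zmodType) : Prop :=
  exists (p q : nat) (A : 'M[int]_(p, q)) (f : {additive 'rV[int]_q -> G}),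
    (forall x : G, exists v, f v = x) /\
    (forall v, f v = 0 <-> exists w : 'rV[int]_p, v = w *m A).

Definition isomorphic (G H : zmodType) : Prop :=
  exists f : {additive G -> H}, bijective f.

(* Main.v *)
(** By the Smith normal form, [G] is [Z^q] modulo the vectors whose [i]-th entry
    is divisible by [d i].  A wedge of [q] circles, the [i]-th one being the
    target of the boundary of a disc that wraps [d i] times around it, has [G]
    as first homology group, and [k - 1] suspensions turn it into a complex [X]
    of dimension at most [k + 1 <= r - 1] with [k]-th homology group [G].
    Enlarge each simplex of a generating family of [X] by new vertices of its
    own until it has dimension [r].  Since the enlarged simplices meet inside
    [X], this does not change the homology; and removing one of them isolates
    the new vertices that it owns.

    Chains are elements of the exterior algebra on all the vertices.  Coning off
    is left multiplication by a vertex, and every homotopy comes from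
    [bd (wedge v c) = c - wedge v (bd c)]. *)

From HB Require Import structures.
Require Import Defs.
From mathcomp Require Import all_boot all_order all_algebra.
From mathcomp Require Import boolp.
From mathcomp Require Import zify ring.

Set Implicit Arguments.
Unset Strict Implicit.
Unset Printing Implicit Defensive.

Import GRing.Theory Num.Theory.
Local Open Scope ring_scope.

(** * The exterior algebra on the vertices *)

(* The coefficient of [set0] is the augmentation, so homology is reduced here. *)
Local Notation exterior n := {ffun {set 'I_n} -> int}.

Section Exterior.
Variable n : nat.
Implicit Types (s t : {set 'I_n}) (u v x y : 'I_n).
Implicit Types (c d w : exterior n) (K P Q R : pred {set 'I_n}).

(** The coefficient of [t] gathers the simplices [i |: t] that have [t] as a face; [vertex_sign t i]
    is also the sign of [i] in [i |: t]. *)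
Definition bd c : exterior n :=
  [ffun t : {set 'I_n} => \sum_(i | i \notin t) vertex_sign t i * c (i |: t)].

Definition wedge v c : exterior n :=
  [ffun s : {set 'I_n} => if v \in s then vertex_sign s v * c (s :\ v) else 0].

(** The interior product with [v]: it carries a chain to the link of [v] and undoes [wedge v] on
    chains free of [v]. *)
Definition contract v c : exterior n :=
  [ffun t : {set 'I_n} => if v \in t then 0 else vertex_sign t v * c (v |: t)].

Fact bd_is_zmod_morphism : zmod_morphism bd.
Proof.
move=> c d; apply/ffunP=> t; rewrite !ffunE -sumrB; apply: eq_bigr => i _.
by rewrite !ffunE mulrBr.
Qed.
HB.instance Definition _ := GRing.isZmodMorphism.Build (exterior n) (exterior n) bd
  bd_is_zmod_morphism.

Fact wedge_is_zmod_morphism v : zmod_morphism (wedge v).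
Proof.
move=> c d; apply/ffunP=> t; rewrite !ffunE; case: ifP; rewrite ?subr0 //.
by rewrite mulrBr.
Qed.
HB.instance Definition _ v := GRing.isZmodMorphism.Build (exterior n) (exterior n)
  (wedge v) (wedge_is_zmod_morphism v).

Fact contract_is_zmod_morphism v : zmod_morphism (contract v).
Proof.
move=> c d; apply/ffunP=> t; rewrite !ffunE; case: ifP; rewrite ?subr0 //.
by rewrite mulrBr.
Qed.
HB.instance Definition _ v := GRing.isZmodMorphism.Build (exterior n) (exterior n)
  (contract v) (contract_is_zmod_morphism v).

Lemma vertex_signK s v : vertex_sign s v * vertex_sign s v = 1.
Proof. by rewrite /vertex_sign -expr2 sqrr_sign. Qed.

Lemma vertex_signU1 s v : vertex_sign (v |: s) v = vertex_sign s v.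
Proof.
rewrite /vertex_sign; congr (_ ^+ _); apply: eq_card => x; rewrite !inE.
by case: eqVneq => // ->; rewrite ltnn !andbF.
Qed.

Lemma vertex_signD1 s v : vertex_sign (s :\ v) v = vertex_sign s v.
Proof.
rewrite /vertex_sign; congr (_ ^+ _); apply: eq_card => x; rewrite !inE.
by case: eqVneq => // ->; rewrite ltnn !andbF.
Qed.

(** Deleting the apex returns [c]. At a simplex without [v], only the term [i = v] survives; at a
    simplex containing [v], the remaining terms of [bd (wedge v c)] and [wedge v (bd c)] cancel by
    [vertex_sign_swap]. *)
Lemma bd_wedge v c : bd (wedge v c) = c - wedge v (bd c).
Proof.
apply/eqP; rewrite eq_sym subr_eq; apply/eqP/ffunP=> t; rewrite !ffunE.
have [vt|vNt] := boolP (v \in t); last first.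
  rewrite (bigD1 v) //= !ffunE setU11 vertex_signU1 mulrA vertex_signK mul1r.
  rewrite setU1K // big1 ?addr0 // => i /andP[it iv]; rewrite !ffunE !inE.
  by rewrite eq_sym (negPf iv) (negPf vNt) mulr0.
rewrite [X in _ + _ * X](bigD1 v) ?setD11 //= vertex_signD1 setD1K //.
rewrite mulrDr mulrA vertex_signK.
rewrite mul1r addrCA mulr_sumr.
rewrite [X in _ + (X + _)](eq_bigl (fun i => (i \notin t :\ v) && (i != v))); last first.
  by move=> i; rewrite !inE; case: eqVneq => [->|]; rewrite ?vt ?andbT.
rewrite -big_split /= big1 ?addr0 // => i /andP[].
rewrite !inE negb_and negbK => + iv; rewrite (negPf iv) /= => iNt.
rewrite !ffunE !inE vt orbT.
have -> : (i |: t) :\ v = i |: t :\ v.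
  by apply/setP=> x; rewrite !inE; case: (eqVneq x i) => // ->; rewrite iv.
rewrite !mulrA -mulrDl.
have := @vertex_sign_swap _ (i |: t) i v (setU11 _ _).
rewrite !inE vt orbT => /(_ isT iv); rewrite vertex_signU1 setU1K // => swap.
suff -> : vertex_sign t i * vertex_sign (i |: t) v
  = - (vertex_sign t v * vertex_sign (t :\ v) i) by rewrite addNr mul0r.
have sgn := vertex_signK t v; have sgn' := vertex_signK (i |: t) v.
have e : vertex_sign ((i |: t) :\ v) i = vertex_sign (t :\ v) i.
  rewrite /vertex_sign; congr (_ ^+ _); apply: eq_card => x; rewrite !inE.
  by case: (eqVneq x i) => // ->; rewrite ltnn !andbF.
move: swap; rewrite e => swap.
rewrite -[LHS]mulr1 -sgn.
transitivity (vertex_sign t i * vertex_sign t v *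
   (vertex_sign (i |: t) v * vertex_sign t v)); first by ring.
rewrite swap -[RHS]mulr1 -sgn'; ring.
Qed.

Lemma wedge_anti u v c : wedge u (wedge v c) = - wedge v (wedge u c).
Proof.
apply/ffunP=> s; rewrite !ffunE !inE.
have [->|uv] := eqVneq u v; first by case: ifP; rewrite ?eqxx ?mulr0 ?oppr0.
case: (boolP (u \in s)) => us; case: (boolP (v \in s)) => vs;
  rewrite ?(eq_sym v) ?uv /= ?mulr0 ?oppr0 //.
rewrite !mulrA vertex_sign_swap // mulNr; congr (- (_ * c _)).
by apply/setP=> x; rewrite !inE andbCA.
Qed.

Lemma wedge2 v c : wedge v (wedge v c) = 0.
Proof. by apply/ffunP=> s; rewrite !ffunE setD11 mulr0 if_same. Qed.

Definition delta s : exterior n := [ffun t : {set 'I_n} => (t == s)%:R].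

Lemma exterior_sum c : c = \sum_s delta s *~ c s.
Proof.
apply/ffunP=> t; rewrite sum_ffunE (bigD1 t) //= big1 ?addr0.
  by rewrite ffunMzE ffunE eqxx intz.
by move=> s st; rewrite ffunMzE ffunE eq_sym (negPf st) mul0rz.
Qed.

Lemma bd_delta0 : bd (delta set0) = 0.
Proof.
apply/ffunP=> t; rewrite !ffunE big1 // => i _; rewrite ffunE.
by rewrite (negPf (_ : i |: t != set0)) ?mulr0 //; apply/set0Pn; exists i; exact: setU11.
Qed.

Lemma wedge_delta v s : v \notin s ->
  wedge v (delta s) = delta (v |: s) *~ vertex_sign s v.
Proof.
move=> vNs; apply/ffunP=> t; rewrite ffunMzE !ffunE.
have [->|ts] := eqVneq t (v |: s).
  by rewrite setU11 setU1K // eqxx mulr1 intz vertex_signU1.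
rewrite mul0rz; case: ifP => // vt; case: eqP => [e|]; rewrite ?mulr0 //.
by move: ts; rewrite -e setD1K ?eqxx.
Qed.

Lemma delta_wedge v s : v \in s ->
  delta s = wedge v (delta (s :\ v)) *~ vertex_sign s v.
Proof.
move=> vs; rewrite wedge_delta ?setD11 // setD1K // -mulrzA vertex_signD1.
by rewrite vertex_signK.
Qed.

(** Induction on the size of [s]: write [delta s] as a cone; two uses of [bd_wedge] turn
    [bd (bd (wedge v c))] into [wedge v (bd (bd c))]. *)
Lemma exterior_bd2_delta s : bd (bd (delta s)) = 0.
Proof.
have [m] := ubnP #|s|; elim: m s => // m IHm s sm.
have [->|/set0Pn[v vs]] := eqVneq s set0; first by rewrite bd_delta0 raddf0.
rewrite (delta_wedge vs) !raddfMz /= bd_wedge raddfB /= bd_wedge IHm.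
  by rewrite raddf0 subr0 subrr mul0rz.
by move: sm; rewrite (cardsD1 v) vs.
Qed.

Lemma bdK c : bd (bd c) = 0.
Proof.
rewrite (exterior_sum c) !raddf_sum big1 // => s _.
by rewrite !raddfMz /= exterior_bd2_delta mul0rz.
Qed.

Definition restrict P c : exterior n := [ffun s => if P s then c s else 0].

Lemma wedge_contract v c :
  c = wedge v (contract v c) + restrict (fun s => v \notin s) c.
Proof.
apply/ffunP=> s; rewrite !ffunE; case: ifP => /= vs; last by rewrite add0r.
by rewrite setD11 addr0 setD1K // mulrA vertex_signD1 vertex_signK mul1r.
Qed.

(** The hypothesis [contract v c = 0] says that [v] occurs in no simplex of [c]. *)
Lemma contract_wedge v c : contract v c = 0 -> contract v (wedge v c) = c.
Proof.
move=> /ffunP c0; apply/ffunP=> s; rewrite !ffunE setU11.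
have := c0 (s :\ v); rewrite !ffunE setD11; case: ifP => vs; last first.
  by move=> _; rewrite setU1K ?vs // mulrA vertex_signU1 vertex_signK mul1r.
rewrite setD1K // vertex_signD1 => /(congr1 (fun a => vertex_sign s v * a)).
by rewrite mulrA vertex_signK mul1r mulr0.
Qed.

Lemma contract2 v c : contract v (contract v c) = 0.
Proof. by apply/ffunP=> s; rewrite !ffunE setU11 mulr0 if_same. Qed.

Lemma contract_restrict v c : contract v (restrict (fun s => v \notin s) c) = 0.
Proof. by apply/ffunP=> s; rewrite !ffunE setU11 mulr0 if_same. Qed.

Lemma contract_bd0 v c : contract v c = 0 -> contract v (bd c) = 0.
Proof.
move=> /ffunP c0; apply/ffunP=> s; rewrite !ffunE; case: ifP => // vs.
rewrite big1 ?mulr0 // => i; rewrite !inE negb_or => /andP[iv is_].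
have := c0 (i |: s); rewrite !ffunE !inE eq_sym (negPf iv) vs /=.
move=> /(congr1 (fun a => vertex_sign (i |: s) v * a)).
rewrite mulrA vertex_signK mul1r mulr0.
by rewrite setUCA => ->; rewrite mulr0.
Qed.

(** After [wedge_contract], only the cone part contributes, and [bd_wedge] gives the sign. Hence
    cycles contract to cycles, and boundaries to boundaries. *)
Lemma contract_bd v c : contract v (bd c) = - bd (contract v c).
Proof.
rewrite {1}(wedge_contract v c) raddfD /= bd_wedge raddfD raddfB /=.
rewrite contract2 contract_wedge; last by rewrite contract_bd0 ?contract2.
by rewrite contract_bd0 ?contract_restrict // sub0r addr0.
Qed.

(** * Chains supported on a family of simplices *)

Definition support P : {pred exterior n} :=
  [pred c : exterior n | [forall s, (c s != 0) ==> P s]].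

Lemma supportP P c : reflect (forall s, ~~ P s -> c s = 0) (c \in support P).
Proof.
apply: (iffP forallP) => cP s; last first.
  by apply/implyP; apply: contraR => /cP ->.
by move=> sP; apply/eqP; apply: contraR sP => cs; exact: implyP (cP s) cs.
Qed.

Fact support_zmod_closed P : zmod_closed (support P).
Proof.
split=> [|c d /supportP cP /supportP dP]; apply/supportP => s sP; rewrite !ffunE //.
by rewrite cP ?dP ?subr0.
Qed.
HB.instance Definition _ P := GRing.isZmodClosed.Build (exterior n) (support P)
  (support_zmod_closed P).

Lemma support_wedge P Q v c :
  (forall s, v \notin s -> P s -> Q (v |: s)) ->
  c \in support P -> wedge v c \in support Q.
Proof.
move=> PQ /supportP cP; apply/supportP=> s sQ; rewrite ffunE; case: ifP => // vs.
rewrite cP ?mulr0 //; apply: contra sQ => /(PQ _ (negbT (setD11 _ _))).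
by rewrite setD1K.
Qed.

Lemma support_contract P Q v c :
  (forall s, v \in s -> P s -> Q (s :\ v)) ->
  c \in support P -> contract v c \in support Q.
Proof.
move=> PQ /supportP cP; apply/supportP=> s sQ; rewrite ffunE; case: ifPn => // vs.
rewrite cP ?mulr0 //; apply: contra sQ => /(PQ _ (setU11 _ _)).
by rewrite setU1K.
Qed.

Lemma support_bd P Q c :
  (forall s i, i \in s -> P s -> Q (s :\ i)) ->
  c \in support P -> bd c \in support Q.
Proof.
move=> PQ /supportP cP; apply/supportP=> s sQ; rewrite ffunE big1 // => i is_.
rewrite cP ?mulr0 //; apply: contra sQ => /(PQ _ _ (setU11 _ _)).
by rewrite setU1K.
Qed.

Lemma support_restrict P Q (R : pred {set 'I_n}) c :
  (forall s, R s -> P s -> Q s) ->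
  c \in support P -> restrict R c \in support Q.
Proof.
move=> PQ /supportP cP; apply/supportP=> s sQ; rewrite ffunE; case: ifPn => // Rs.
by rewrite cP //; apply: contra sQ; exact: PQ Rs.
Qed.

Definition chains K k := support (fun s => K s && (#|s| == k.+1)).

Definition boundaries K k : {pred exterior n} :=
  fun c => `[< exists2 w, w \in chains K k.+1 & c = bd w >].

Lemma boundariesP K k c :
  reflect (exists2 w, w \in chains K k.+1 & c = bd w) (c \in boundaries K k).
Proof. exact: asboolP. Qed.

Fact boundaries_zmod_closed K k : zmod_closed (boundaries K k).
Proof.
split=> [|c d /boundariesP[w wK ->] /boundariesP[w' wK' ->]]; apply/boundariesP.
  by exists 0; rewrite ?rpred0 ?raddf0.
by exists (w - w'); rewrite ?rpredB ?raddfB.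
Qed.
HB.instance Definition _ K k := GRing.isZmodClosed.Build (exterior n)
  (boundaries K k) (boundaries_zmod_closed K k).

Lemma chains_wedge K K' v k c :
  (forall s, v \notin s -> K s -> K' (v |: s)) ->
  c \in chains K k -> wedge v c \in chains K' k.+1.
Proof.
move=> KK'; apply: support_wedge => s vs /andP[/(KK' _ vs)-> /eqP sk] /=.
by rewrite cardsU1 vs sk add1n.
Qed.

Lemma chains_contract K K' v k c :
  (forall s, v \in s -> K s -> K' (s :\ v)) ->
  c \in chains K k.+1 -> contract v c \in chains K' k.
Proof.
move=> KK'; apply: support_contract => s vs /andP[/(KK' _ vs)-> /eqP sk] /=.
by move: sk; rewrite (cardsD1 v) vs add1n => -[->].
Qed.

Lemma chains_bd K K' k c :
  (forall s v, v \in s -> K s -> K' (s :\ v)) ->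
  c \in chains K k.+1 -> bd c \in chains K' k.
Proof.
move=> KK'; apply: support_bd => s v vs /andP[/(KK' _ _ vs)-> /eqP sk] /=.
by move: sk; rewrite (cardsD1 v) vs add1n => -[->].
Qed.

Lemma chains_restrict K K' (R : pred {set 'I_n}) k c :
  (forall s, R s -> K s -> K' s) ->
  c \in chains K k -> restrict R c \in chains K' k.
Proof.
move=> KK'; apply: support_restrict => s Rs /andP[/(KK' _ Rs)-> ->].
by [].
Qed.

Lemma chains_sub K K' k c :
  (forall s, K s -> K' s) -> c \in chains K k -> c \in chains K' k.
Proof.
move=> KK' /supportP cK; apply/supportP => s sK'; apply: cK.
by apply: contra sK' => /andP[/KK'-> ->].
Qed.

(* The [k]-th homology group of [K] is [Z^q] modulo the subgroup [Z]. *)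
Definition presents K (k q : nat) (Z : 'rV[int]_q -> Prop) :=
  exists l : {additive 'rV[int]_q -> exterior n},
  [/\ forall a, l a \in chains K k /\ bd (l a) = 0,
      forall z, z \in chains K k -> bd z = 0 ->
        exists a, z - l a \in boundaries K k &
      forall a, l a \in boundaries K k <-> Z a].

(** * Suspension *)

Definition susp (x y : 'I_n) K : pred {set 'I_n} :=
  fun s => K (s :\ x) || K (s :\ y).

(** The suspension sends a cycle to the difference of its two cones, whose boundaries agree.
    Contraction by [x] detects the boundaries; conversely, once its part at [x] is cleared, a cycle
    lies in the cone with apex [y] and bounds. *)
Lemma presents_susp K k q Z x y :
  (forall s t, t \subset s -> K s -> K t) ->
  (forall s, K s -> (x \notin s) && (y \notin s)) -> x != y ->
  @presents K k q Z -> presents (susp x y K) k.+1 Z.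
Proof.
move=> Ksub Kxy xy [l [l_cyc l_span l_ker]].
have Kx s v : v \in [:: x; y] -> v \notin s -> K s -> susp x y K (v |: s).
  by rewrite !inE /susp => /orP[] /eqP-> vs Ks; rewrite setU1K // Ks ?orbT.
have Kw v k' c : v \in [:: x; y] -> c \in chains K k' ->
    wedge v c \in chains (susp x y K) k'.+1.
  by move=> vxy; apply: chains_wedge => s; exact: Kx.
have K_susp s : K s -> susp x y K s.
  by move=> Ks; rewrite /susp (Ksub s) // subD1set.
have K_contract k' c : c \in chains (susp x y K) k'.+1 ->
    contract x c \in chains K k'.
  apply: chains_contract => s xs /orP[] //; move/Kxy; rewrite !inE xs xy //.
have K_free k' c : c \in chains K k' -> contract x c = 0.
  move=> /supportP cK; apply/ffunP=> s; rewrite !ffunE; case: ifP => // _.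
  rewrite cK ?mulr0 //; apply/negP => /andP[/Kxy].
  by rewrite setU11.
pose l' a := wedge x (l a) - wedge y (l a).
have l'B : zmod_morphism l'.
  move=> a b; rewrite /l' !raddfB /=.
  by apply/ffunP => s; rewrite !ffunE; ring.
pose l'A := GRing.isZmodMorphism.Build _ _ l' l'B.
exists (HB.pack_for {additive 'rV[int]_q -> exterior n} l' l'A); split => /=.
- move=> v; have [lv lv0] := l_cyc v; split.
    by rewrite rpredB // Kw // !inE eqxx ?orbT.
  by rewrite raddfB /= !bd_wedge lv0 !raddf0 !addr0 subrr.
- move=> z zK z0; set u := contract x z.
  have uK : u \in chains K k by exact: K_contract.
  have u0 : bd u = 0.
    by apply/eqP; rewrite -oppr_eq0 -contract_bd z0 raddf0.
  have [v /boundariesP[w wK uE]] := l_span u uK u0.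
  (* [t] is [z - l' v] with [bd (wedge x w)] added to clear the simplices containing [x]; being a
     cycle in the cone over [K] with apex [y], it is the boundary of [wedge y t]. *)
  exists v; pose z' := restrict (fun s => x \notin s) z.
  pose t := wedge y (l v) + w + z'.
  have t_supp : t \in chains (fun s => K (s :\ y)) k.+1.
    rewrite rpredD ?rpredD //.
    - by apply: chains_wedge (l_cyc v).1 => s vs Ks; rewrite setU1K.
    - by apply: chains_sub wK => s; apply: Ksub; exact: subD1set.
    apply: chains_restrict zK => s xs /orP[] // Ks.
    by apply: Ksub Ks; rewrite subsetD1 subD1set inE (negPf xs) andbF.
  have zE : z = wedge x u + z' by exact: wedge_contract.
  have tE : z - l' v = t - bd (wedge x w).
    rewrite bd_wedge zE /t /l'; move/eqP: uE; rewrite subr_eq => /eqP ->.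
    rewrite raddfD /=.
    move: (wedge x (bd w)) (wedge x (l v)) (wedge y (l v)) => a b c.
    apply/eqP; rewrite -subr_eq0; apply/eqP/ffunP => s; rewrite !ffunE; ring.
  have t0 : bd t = 0.
    have -> : t = z - l' v + bd (wedge x w) by rewrite tE subrK.
    rewrite raddfD raddfB /= z0 bdK addr0 sub0r /l' raddfB /= !bd_wedge.
    by rewrite (l_cyc v).2 !raddf0 !addr0 subrr oppr0.
  rewrite tE rpredB //; apply/boundariesP; last first.
    by exists (wedge x w); rewrite ?Kw ?inE ?eqxx.
  exists (wedge y t); last by rewrite bd_wedge t0 raddf0 subr0.
  apply: chains_wedge t_supp => s ys Ks; apply/orP; right.
  by rewrite setU1K //; apply: Ksub Ks; rewrite subsetD1 ys subxx.
move=> v; have [lv lv0] := l_cyc v; split; last first.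
  move/l_ker/boundariesP=> [w wK lE]; apply/boundariesP.
  exists (wedge y w - wedge x w); first by rewrite rpredB // Kw ?inE ?eqxx ?orbT.
  rewrite raddfB /= !bd_wedge /l' -lE opprB addrA addrC.
  apply/ffunP => s; rewrite !ffunE; ring.
(* Contracting by [x] turns [l' v = bd w] into [l v = - bd (contract x w)]. *)
move/boundariesP=> [w wK /(congr1 (contract x))]; rewrite contract_bd.
rewrite /l' raddfB /= contract_wedge ?(K_free _ _ lv) //.
have -> : contract x (wedge y (l v)) = 0.
  apply/ffunP=> s; rewrite !ffunE; case: ifP => // _; case: ifP => _; last by rewrite mulr0.
  rewrite (supportP _ _ lv) ?mulr0 //; apply/negP => /andP[/Kxy].
  by rewrite !inE (negPf xy) eqxx.
rewrite subr0 => lE; apply/l_ker/boundariesP; exists (- contract x w).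
  by rewrite rpredN K_contract.
by rewrite raddfN.
Qed.
End Exterior.

(** * Enlarging simplices by private vertices *)

Definition down n (J : finType) (F : J -> {set 'I_n}) : pred {set 'I_n} :=
  fun s => [exists j, s \subset F j].

Lemma down_sub n (J : finType) (F : J -> {set 'I_n}) (s t : {set 'I_n}) :
  t \subset s -> down F s -> down F t.
Proof. by move=> ts /existsP[j sj]; apply/existsP; exists j; exact: subset_trans sj. Qed.

Section Thickening.
Variables (n : nat) (J : finType) (core F : J -> {set 'I_n}) (b : J -> 'I_n).
Implicit Types (s t : {set 'I_n}) (c w : exterior n) (i j : J).
Hypothesis coreF : forall j, core j \subset F j.
Hypothesis core_b : forall j, b j \in core j.
Hypothesis private : forall j j' x, j != j' -> x \in F j -> x \in F j' -> x \in core j.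

Let meets j : pred {set 'I_n} := fun s => ~~ (s :&: F j \subset core j).

Let meetsP j s : reflect (exists x, [/\ x \in s, x \in F j & x \notin core j]) (meets j s).
Proof.
apply: (iffP subsetPn) => [[x /setIP[xs xF] xc]|[x [xs xF xc]]]; exists x => //.
exact/setIP.
Qed.

(** A vertex of [F j] outside [core j] belongs to no other [F j'], by [private]. *)
Let meets_sub j s : meets j s -> down F s -> s \subset F j.
Proof.
move=> /meetsP[x [xs xF xc]] /existsP[j' sj']; have [-> //|jj'] := eqVneq j j'.
by case/negP: xc; apply: private jj' xF _; exact: subsetP sj' _ xs.
Qed.

Let meets_core j s : meets j s -> ~~ down core s.
Proof.
move=> ms; apply/existsP => -[j' sj']; case/meetsP: ms => x [xs xF xc].
have xj' := subsetP sj' _ xs; have [e|jj'] := eqVneq j j'.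
  by case/negP: xc; rewrite e.
by case/negP: xc; apply: private jj' xF _; exact: subsetP (coreF _) _ xj'.
Qed.

(* The part of [c] that meets the private vertices of [j] is a cone with apex
   [b j], up to a boundary and chains of the core. *)
Lemma push_to_core k c : c \in chains (down F) k.+1 -> bd c \in support (down core) ->
  exists2 w, w \in chains (down F) k.+2 & c - bd w \in chains (down core) k.+1.
Proof.
move=> cF /supportP bdc; pose c_ j := restrict (meets j) c.
have c_F j : c_ j \in chains (fun s => s \subset F j) k.+1.
  exact: (chains_restrict (@meets_sub j)) cF.
have sub_down (G : J -> {set 'I_n}) j s : s \subset G j -> down G s.
  by move=> sj; apply/existsP; exists j.
exists (\sum_j wedge (b j) (c_ j)).
  apply: rpred_sum => j _; apply: chains_wedge (c_F j) => s _ sj; apply: (@sub_down _ j).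
  by rewrite subUset sub1set sj (subsetP (coreF j)).
have -> : c - bd (\sum_j wedge (b j) (c_ j)) =
    (c - \sum_j c_ j) + \sum_j wedge (b j) (bd (c_ j)).
  rewrite raddf_sum -addrA; congr (_ + _).
  rewrite -!sumrN -big_split /=; apply: eq_bigr => j _.
  by rewrite bd_wedge opprB addrC.
(* In the first summand, a simplex meeting the private vertices of [j] occurs in [c_ j] only and
   cancels; a simplex meeting none of them lies in a core. *)
rewrite rpredD //.
  apply/supportP => s; rewrite !ffunE sum_ffunE => sN.
  have [/forallP sNm|] := boolP [forall j, ~~ meets j s].
    rewrite big1 ?subr0; last by move=> j _; rewrite ffunE (negPf (sNm j)).
    apply: (supportP _ _ cF); apply: contra sN => /andP[/existsP[j sj] ->].
    rewrite andbT; apply: (@sub_down _ j); have := sNm j.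
    by rewrite /meets negbK (setIidPl sj).
  rewrite negb_forall => /existsP[j]; rewrite negbK => mj.
  rewrite (bigD1 j) //= ffunE mj big1 ?addr0 ?subrr // => i ij; rewrite ffunE.
  case: ifP => // mi; apply: (supportP _ _ cF).
  apply/negP => /andP[/(meets_sub mi) si _]; case/meetsP: mj => x [xs xF xc].
  by case/negP: xc; apply: (@private j i); rewrite 1?eq_sym // (subsetP si).
apply: rpred_sum => j _.
apply: (@chains_wedge _ (fun s => s \subset core j)) => [s _ sj|].
  by apply: (@sub_down _ j); rewrite subUset sub1set core_b.
(* If [s] meets the private vertices of [j], so does every simplex having it as a face; thus
   [bd (c_ j)] agrees at [s] with [bd c], which vanishes outside the core. *)
apply/supportP => s sN; have [mj|mj] := boolP (meets j s).
  rewrite -[RHS](bdc s (meets_core mj)) !ffunE; apply: eq_bigr => i is_.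
  rewrite ffunE; case: ifPn => // /negP[]; case/meetsP: mj => x [xs xF xc].
  by apply/meetsP; exists x; rewrite inE xs orbT.
have : bd (c_ j) \in chains (fun s => s \subset F j) k.
  by apply: chains_bd (c_F j) => t x _; apply: subset_trans; exact: subD1set.
move/supportP; apply; apply: contra sN => /andP[sj ->]; rewrite andbT.
by move: mj; rewrite /meets negbK (setIidPl sj).
Qed.

(** [push_to_core] serves twice: it moves a cycle into the core within its homology class, and it
    moves a chain filling a core cycle into the core without changing its boundary. *)
Lemma presents_thicken k q Z :
  @presents n (down core) k.+1 q Z -> presents (down F) k.+1 Z.
Proof.
have core_F s : down core s -> down F s.
  by move=> /existsP[j sj]; apply/existsP; exists j; exact: subset_trans sj (coreF j).
move=> [l [l_cyc l_span l_ker]]; exists l; split.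
- by move=> a; have [la la0] := l_cyc a; split=> //; apply: chains_sub la.
- move=> z zF z0; have [|w wF zw] := push_to_core zF; first by rewrite z0 rpred0.
  have [|a /boundariesP[u uK e]] := l_span _ zw; first by rewrite raddfB /= z0 bdK subr0.
  exists a; apply/boundariesP; exists (u + w).
    by rewrite rpredD //; apply: chains_sub uK.
  by rewrite raddfD /= -e addrAC subrK.
move=> a; rewrite -l_ker; split=> /boundariesP[w wF e]; apply/boundariesP; last first.
  by exists w => //; apply: chains_sub wF.
have [|u uF wu] := push_to_core wF; last first.
  by exists (w - bd u) => //; rewrite raddfB /= bdK subr0.
rewrite -e; have /supportP la := (l_cyc a).1; apply/supportP => s sN.
by apply: la; apply: contra sN => /andP[].
Qed.

End Thickening.

(** * Homology from the exterior algebra *)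

Section HomologyOfExterior.
Local Open Scope quotient_scope.
Variables (n : nat) (Y : simplicial_complex n).

Definition extend k (c : chain Y k) : exterior n :=
  [ffun s : {set 'I_n} => oapp c 0 (insub s : option (simplex Y k))].

Definition coefficients k (c : exterior n) : chain Y k := [ffun u => c (val u)].

Lemma extendE k (c : chain Y k) u : extend c (val u) = c u.
Proof. by rewrite ffunE valK. Qed.

Lemma extend_chains k (c : chain Y k) : extend c \in chains (mem Y) k.
Proof. by apply/supportP => s sY; rewrite ffunE insubN. Qed.

Lemma coefficientsK k c : c \in chains (mem Y) k -> extend (coefficients k c) = c.
Proof.
move=> /supportP cY; apply/ffunP => s; rewrite ffunE; case: insubP => [u _ <-|/cY//].
by rewrite /= ffunE.
Qed.

Lemma extendK k : cancel (@extend k) (coefficients k).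
Proof. by move=> c; apply/ffunP=> u; rewrite ffunE extendE. Qed.

Fact coefficients_is_zmod_morphism k : zmod_morphism (coefficients k).
Proof. by move=> c d; apply/ffunP=> u; rewrite !ffunE. Qed.
HB.instance Definition _ k := GRing.isZmodMorphism.Build (exterior n) (chain Y k)
  (coefficients k) (coefficients_is_zmod_morphism k).

Lemma boundary_extend k (c : chain Y k.+1) :
  boundary c = coefficients k (bd (extend c)).
Proof.
apply/ffunP => t; rewrite !ffunE.
under eq_bigr => u _ do rewrite /incidence mulr_sumr big_mkcond /=.
rewrite exchange_big [RHS]big_mkcond /=; apply: eq_bigr => i _.
have [it|iNt] := boolP (i \in val t).
  by apply: big1 => u _; case: ifP => // /andP[_ /eqP e]; move: it;
    rewrite (e : val t = _) setD11.
rewrite ffunE; case: insubP => [u _ uE|uN].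
  rewrite (bigD1 u) //= uE setU11 setU1K // eqxx vertex_signU1 mulrC.
  rewrite big1 ?addr0 // => w wu; case: ifP => // /andP[iw /eqP e].
  by case/eqP: wu; apply: val_inj; rewrite uE e setD1K.
rewrite mulr0 big1 // => u _; case: ifP => // /andP[iu /eqP e].
by case/negP: uN; rewrite (e : val t = _) setD1K // (valP u).
Qed.

(** Degree 0 has to be excluded: there [bd] is the augmentation, placed at [set0], while [boundary]
    is zero. In higher degree the faces are nonempty and so belong to [Y]. *)
Lemma bd_extend k (c : chain Y k.+1) : bd (extend c) = extend (boundary c).
Proof.
rewrite boundary_extend coefficientsK //.
have /supportP cY := extend_chains c.
apply/supportP => t tN; rewrite ffunE big1 // => i it; rewrite cY ?mulr0 //.
apply: contra tN => /andP[/= iY]; rewrite cardsU1 it add1n eqSS => tk.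
rewrite tk andbT; apply: simplicesS iY (subsetUr _ _) _.
by rewrite -card_gt0 (eqP tk).
Qed.

(** The group [G] and the homology group are both quotients of [Z^q], through [f] and [P], with the
    same kernel; sections of the two surjections yield inverse maps. *)
Lemma isomorphic_homology k q (G : zmodType) (f : {additive 'rV[int]_q -> G}) :
  (forall x, exists v, f v = x) ->
  presents (mem Y) k.+1 (fun v => f v = 0) -> isomorphic (homology Y k.+1) G.
Proof.
move=> f_surj [l [l_cyc l_span l_ker]].
have cycP a : coefficients k.+1 (l a) \in @cycle_pred n Y k.+1.
  rewrite unfold_in boundary_extend coefficientsK ?(l_cyc a).1 //.
  by rewrite (l_cyc a).2 raddf0.
pose Q := Quotient.quot (@boundary_pred n Y k.+1).
pose p a : Q := \pi_Q (KCycle (cycP a)).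
have pB : zmod_morphism p.
  move=> a b; rewrite /p -raddfB; congr (\pi_Q _); apply: val_inj => /=.
  by rewrite !raddfB.
pose pA := GRing.isZmodMorphism.Build _ _ p pB.
pose P := HB.pack_for {additive 'rV[int]_q -> Q} p pA.
have p_eq0 a : P a = 0 <-> f a = 0.
  apply: (iff_trans (B := KCycle (cycP a) \in @boundary_pred n Y k.+1)).
    rewrite -[KCycle _]subr0 Quotient.idealrBE raddf0.
    by split=> /eqP.
  apply: iff_trans (l_ker a).
  split=> [/asboolP[c /= e]|/boundariesP[w wY e]].
    apply/boundariesP; exists (extend c); first exact: extend_chains.
    rewrite bd_extend -e coefficientsK //; exact: (l_cyc a).1.
  apply/asboolP; exists (coefficients k.+2 w) => /=.
  by rewrite boundary_extend coefficientsK // -e.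
have p_surj x : exists a, P a = x.
  rewrite -[x]reprK; move: (repr x) => [z zc]; have z0 : bd (extend z) = 0.
    rewrite bd_extend (eqP zc); apply/ffunP=> s; rewrite !ffunE.
    by case: insub => // u; rewrite /= ffunE.
  have [a /boundariesP[w wY e]] := l_span _ (extend_chains z) z0.
  exists a; apply/esym/eqP; rewrite /= /p -Quotient.idealrBE; apply/asboolP.
  exists (coefficients k.+2 w) => /=.
  by rewrite boundary_extend coefficientsK // -e raddfB /= extendK.
have [g gP] := choice p_surj; have [h hP] := choice f_surj.
have fP a b : P a = P b <-> f a = f b.
  by split=> /eqP; rewrite -subr_eq0 -raddfB => /eqP /p_eq0/eqP;
    rewrite raddfB subr_eq0 => /eqP.
(* The section [g] need not be additive, but [F] is, since by [fP] the value of [f] depends only on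
   the class under [P]. *)
pose F x := f (g x).
have FB : zmod_morphism F.
  by move=> x y; rewrite /F -raddfB; apply/fP; rewrite raddfB !gP.
pose FA := GRing.isZmodMorphism.Build _ _ F FB.
exists (HB.pack_for {additive Q -> G} F FA); exists (fun y => P (h y)) => [x|y] /=.
  by rewrite -[RHS]gP; apply/fP; rewrite hP.
by rewrite /F -[RHS]hP; apply/fP; rewrite gP.
Qed.

End HomologyOfExterior.

(** * Complexes with labelled vertices *)

Section OrientedSimplices.
Variables (n : nat) (T : finType) (v : T -> 'I_n).
Hypothesis v_inj : injective v.
Implicit Types (s : {set 'I_n}) (c d w z : exterior n).

Definition vertex1 x : exterior n := wedge (v x) (delta set0).
Definition edge x y := wedge (v x) (vertex1 y).
Definition triangle (x y z : T) := wedge (v x) (edge y z).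

Lemma bd_vertex1 x : bd (vertex1 x) = delta set0.
Proof. by rewrite bd_wedge bd_delta0 raddf0 subr0. Qed.

Lemma bd_edge x y : bd (edge x y) = vertex1 y - vertex1 x.
Proof. by rewrite bd_wedge bd_vertex1. Qed.

Lemma bd_triangle (x y z : T) :
  bd (triangle x y z) = edge x y + edge y z - edge x z.
Proof. by rewrite bd_wedge bd_edge raddfB /= opprB addrC addrAC. Qed.

Lemma edgexx x : edge x x = 0.
Proof. exact: wedge2. Qed.

Lemma edgeC x y : edge y x = - edge x y.
Proof. exact: wedge_anti. Qed.

Lemma vertex_sign0 (u : 'I_n) : vertex_sign set0 u = 1.
Proof. by rewrite /vertex_sign eq_card0 // => i; rewrite !inE. Qed.

Lemma vertex1E x : vertex1 x = delta [set v x].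
Proof. by rewrite /vertex1 wedge_delta ?inE // vertex_sign0 setU0 mulr1z. Qed.

Lemma edge_delta x y : x != y ->
  edge x y = delta [set v x; v y] *~ ((-1) ^+ (v y < v x)%N).
Proof.
move=> xy; rewrite /edge vertex1E wedge_delta ?inE ?(inj_eq v_inj) //.
congr (_ *~ (_ ^+ _)); rewrite -[RHS]/(nat_of_bool _).
have -> : [set j in [set v y] | (j < v x)%N] = if (v y < v x)%N then [set v y] else set0.
  by apply/setP=> i; case: ifP => yx; rewrite !inE; case: eqVneq => // ->; rewrite yx.
by case: ifP; rewrite ?cards1 ?cards0.
Qed.

Lemma mulrz_sign (M : zmodType) (a : M) (e : int) : e * e = 1 -> a *~ e *~ e = a.
Proof. by rewrite -mulrzA => ->. Qed.

Lemma delta_edge x y : x != y ->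
  delta [set v x; v y] = edge x y *~ ((-1) ^+ (v y < v x)%N).
Proof. by move=> xy; rewrite edge_delta // mulrz_sign // -expr2 sqrr_sign. Qed.

(** The integer [e] is a sign, left implicit because only divisibility is tested on triangles. *)
Lemma delta_triangle (x y z : T) : #|[set v x; v y; v z]| = 3 ->
  exists e : int, delta [set v x; v y; v z] = triangle x y z *~ e.
Proof.
rewrite -setUA !cardsU1 cards1 !inE !(inj_eq v_inj) negb_or.
case xy: (x == y) => //=; case xz: (x == z) => //=; case yz: (y == z) => //= _.
exists (vertex_sign [set v y; v z] (v x) * ((-1) ^+ (v z < v y)%N)).
rewrite /triangle edge_delta ?yz // raddfMz /= wedge_delta; last first.
  by rewrite !inE !(inj_eq v_inj) xy xz.
rewrite -!mulrzA; set a := vertex_sign _ _; set b := _ ^+ _.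
rewrite [X in _ *~ X](_ : _ = (a * a) * (b * b)); last by ring.
by rewrite vertex_signK /b -expr2 sqrr_sign.
Qed.

Lemma chains_face_wedge (A : {set 'I_n}) (x : T) k c : v x \in A ->
  c \in chains (fun s => s \subset A) k ->
  wedge (v x) c \in chains (fun s => s \subset A) k.+1.
Proof. by move=> xA; apply: chains_wedge => s _ sA; rewrite subUset sub1set xA. Qed.

Lemma edge_face (A : {set 'I_n}) x y : v x \in A -> v y \in A ->
  edge x y \in chains (fun s => s \subset A) 1.
Proof.
move=> xA yA; apply: chains_face_wedge => //.
rewrite vertex1E; apply/supportP => s; rewrite ffunE.
by have [->|//] := eqVneq s [set v y]; case/negP; rewrite cards1 andbT sub1set.
Qed.

Section Complex.
Variables (J : finType) (core : J -> {set T}).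
Local Notation K := (down (fun j => v @: core j)).

Let face_down j (s : {set 'I_n}) : s \subset v @: core j -> K s.
Proof. by move=> sj; apply/existsP; exists j. Qed.

Lemma edge_chains j x y : x \in core j -> y \in core j -> edge x y \in chains K 1.
Proof.
move=> xj yj; apply: chains_sub (edge_face (imset_f v xj) (imset_f v yj)).
exact: face_down.
Qed.

Lemma triangle_boundaries j (x y z : T) : x \in core j -> y \in core j -> z \in core j ->
  edge x y + edge y z - edge x z \in boundaries K 1.
Proof.
move=> xj yj zj; apply/boundariesP; exists (triangle x y z); last by rewrite bd_triangle.
have := chains_face_wedge (imset_f v xj) (edge_face (imset_f v yj) (imset_f v zj)).
by apply: chains_sub; apply: face_down.
Qed.

(* If [p x] joins a base point to [x], then every cycle is a combination of the
   loops [p x + edge x y - p y]. *)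
Lemma cycle_span q (l : {additive 'rV[int]_q -> exterior n}) (p : T -> exterior n) :
  (forall x y j, x \in core j -> y \in core j ->
    exists a, p x + edge x y - p y - l a \in boundaries K 1) ->
  forall z, z \in chains K 1 -> bd z = 0 -> exists a, z - l a \in boundaries K 1.
Proof.
move=> El z zK z0.
(* With [p] extended additively, [z - P (bd z)] is [z] for a cycle and [p x + edge x y - p y] for an
   edge, so the claim can be checked simplex by simplex. *)
pose P (c : exterior n) := \sum_x p x *~ c [set v x].
have PB : zmod_morphism P.
  move=> c d; rewrite /P -sumrB; apply: eq_bigr => x _.
  by rewrite !ffunE mulrzBr.
pose PA := GRing.isZmodMorphism.Build _ _ P PB.
pose P' := HB.pack_for {additive exterior n -> exterior n} P PA.
have P_vertex x : P' (vertex1 x) = p x.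
  rewrite /= /P vertex1E (bigD1 x) //= ffunE eqxx mulr1z big1 ?addr0 // => y yx.
  by rewrite ffunE (inj_eq set1_inj) (inj_eq v_inj) (negPf yx) mulr0z.
suff [a] : exists a, z - P' (bd z) - l a \in boundaries K 1.
  by rewrite z0 raddf0 subr0; exists a.
have mulW c (m : int) : (exists a, c - P' (bd c) - l a \in boundaries K 1) ->
    exists a, c *~ m - P' (bd (c *~ m)) - l a \in boundaries K 1.
  case=> a ca; exists (a *~ m). rewrite !raddfMz.
  by rewrite -!mulrzDl rpredMz.
rewrite (exterior_sum z); elim/big_ind: _ => [|c d [a ca] [b db]|s _].
- by exists 0; rewrite !raddf0 !addr0 rpred0.
- exists (a + b); have -> : c + d - P' (bd (c + d)) - l (a + b) =
      (c - P' (bd c) - l a) + (d - P' (bd d) - l b).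
    rewrite (raddfD (@bd n)) (raddfD P') (raddfD l); apply/ffunP => t; rewrite !ffunE; ring.
  exact: rpredD.
have [->|zs] := eqVneq (z s) 0.
  by exists 0; rewrite mulr0z !raddf0 !addr0 rpred0.
apply: (mulW); have : K s && (#|s| == 2).
  by apply: contraR zs => sN; rewrite (supportP _ _ zK).

case/andP => /existsP[j sj] /cards2P[u [w [uw sE]]].
have /imsetP[x xj xu] : u \in v @: core j by apply: subsetP sj _ _; rewrite sE !inE eqxx.
have /imsetP[y yj yw] : w \in v @: core j.
  by apply: subsetP sj _ _; rewrite sE !inE eqxx orbT.
have xy : x != y by rewrite -(inj_eq v_inj) -xu -yw.
rewrite sE xu yw delta_edge //; apply: mulW.
have [a ea] := El x y j xj yj; exists a; rewrite bd_edge raddfB !P_vertex.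
by rewrite opprB addrCA addrA.
Qed.

(** [Theta] evaluates the cochain [lam]. On the boundary of a triangle it takes the value assumed
    divisible by [m], and a core with at most two points contains no triangle. *)
Lemma cocycle_boundaries (m : int) (lam : T -> T -> int) :
  (forall x y, lam y x = - lam x y) ->
  (forall j, (#|core j| <= 2)%N \/ exists x y z : T, core j = [set x; y; z] /\
    (m %| lam x y + lam y z - lam x z)%Z) ->
  exists Theta : {additive exterior n -> int},
    (forall x y, Theta (edge x y) = lam x y) /\
    (forall c, c \in boundaries K 1 -> (m %| Theta c)%Z).
Proof.
move=> lamC lam_core.
have lamxx x : lam x x = 0.
  by have := lamC x x; lia.
(* The condition [v e.1 < v e.2] counts each edge once, in its increasing direction. *)
pose Th (c : exterior n) :=
  \sum_(e : T * T | (v e.1 < v e.2)%N) c [set v e.1; v e.2] * lam e.1 e.2.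
have ThB : zmod_morphism Th.
  move=> c d; rewrite /Th -sumrB; apply: eq_bigr => x _.
  by rewrite !ffunE mulrBl.
pose ThA := GRing.isZmodMorphism.Build _ _ Th ThB.
pose Theta := HB.pack_for {additive exterior n -> int} Th ThA.
have lt_edge x y : (v x < v y)%N -> Th (edge x y) = lam x y.
  move=> lt_xy; have xy : x != y by apply: contraTneq lt_xy => ->; rewrite ltnn.
  rewrite /Th (bigD1 (x, y)) //= edge_delta // ffunMzE ffunE eqxx.
  rewrite ltnNge (ltnW lt_xy) mulr1z mul1r big1 ?addr0 // => -[x' y'] /=.
  case/andP => lt_xy' ne; rewrite mulr1z ffunE; case: eqP => [e|]; last by rewrite mul0r.
  case/negP: ne; rewrite xpair_eqE -!(inj_eq v_inj).
  have /setP E := e.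
  have := E (v x'); have := E (v y'); have := E (v x); have := E (v y).
  rewrite !inE !eqxx ?orbT -!val_eqE /= => h1 h2 h3 h4; lia.
have Theta_edge x y : Theta (edge x y) = lam x y.
  have [->|xy] := eqVneq x y; first by rewrite edgexx raddf0 lamxx.
  have [||e] := ltngtP (v x) (v y); first exact: lt_edge.
    by move=> yx; rewrite edgeC raddfN lamC [Theta _]lt_edge.
  by case/eqP: xy; apply/v_inj/val_inj.
exists Theta; split=> // _ /boundariesP[w wK ->].
rewrite (exterior_sum w) !raddf_sum; apply: rpred_sum => s _.
rewrite !raddfMz /=.
have [->|ws] := eqVneq (w s) 0; first by rewrite mulr0z rpred0.
apply: rpredMz; have : K s && (#|s| == 3).
  by apply: contraR ws => sN; rewrite (supportP _ _ wK).
case/andP => /existsP[j sj] /eqP s3.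
have := subset_leq_card sj; rewrite s3 card_imset //.
case: (lam_core j) => [le2 /leq_trans/(_ le2)//|[x [y [z [cE dvd]]]] c3].
have sE : s = [set v x; v y; v z].
  have <- : v @: core j = [set v x; v y; v z] by rewrite cE !imsetU !imset_set1.
  apply/eqP; rewrite eqEcard sj s3 card_imset // cE -setUA.
  by rewrite !cardsU1 cards1; case: (_ \notin _); case: (_ \notin _).
rewrite sE in s3 *; have [e ->] := delta_triangle s3.
rewrite -[Th _]/(Theta _) !raddfMz; apply: rpredMz.
rewrite [X in Theta X]bd_triangle.
by rewrite raddfB raddfD !Theta_edge.
Qed.

End Complex.
End OrientedSimplices.

(** * A triangulated wedge of Moore spaces *)

Section MooreComplex.
Variables (q : nat) (d : 'I_q -> nat).

(* [None] is the base point, common to all the circles; [inl] gives the two other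
   vertices of each circle, and [inr] the vertices of the discs. *)
Definition moore_vertex : Type :=
  option ('I_q * bool + {i : 'I_q & 'I_(3 * d i)}).
HB.instance Definition _ := Finite.on moore_vertex.

(** [inl] indexes the edges of the circles and [inr] the triangles, three for each disc vertex;
    [None] puts the base point in a face even when [q = 0]. *)
Definition moore_face : Type :=
  option ('I_q * 'I_3 + {i : 'I_q & 'I_(3 * d i)} * 'I_3).
HB.instance Definition _ := Finite.on moore_face.

(** The circle is a triangle. Allowing every natural number as index lets the boundary of a disc run
    through [3 * d i] consecutive steps, that is, [d i] turns. *)
Definition rim i m : moore_vertex :=
  match m %% 3 with
  | 0 => None
  | 1 => Some (inl (i, false))
  | _ => Some (inl (i, true))
  end%N.

(* The index [m] counts modulo [3 * d i].  There is no disc when [d i = 0], and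
   [disc i m] is then the base point. *)
Definition disc i m : moore_vertex :=
  if (insub (m %% (3 * d i))%N : option 'I_(3 * d i)) is Some u
  then Some (inr (Tagged (fun i => 'I_(3 * d i)) u)) else None.

(** The triangles with [e = 0] and [e = 1] form a collar between the polygon of the disc vertices
    and the circle; those with [e = 2] fan the polygon from [disc i 0] and degenerate to edges at
    both ends. *)
Definition moore (j : moore_face) : {set moore_vertex} :=
  match j with
  | None => [set None]
  | Some (inl (i, m)) => [set rim i m; rim i m.+1]
  | Some (inr (u, e)) =>
    let i := tag u in let m := nat_of_ord (tagged u) in
    match nat_of_ord e with
    | 0%N => [set disc i m; disc i m.+1; rim i m]
    | 1%N => [set disc i m.+1; rim i m; rim i m.+1]
    | _ => [set disc i 0; disc i m; disc i m.+1]
    end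
  end.

Lemma rim_mod3 i m a : rim i (a + m %% 3) = rim i (a + m).
Proof. by rewrite /rim modnDmr. Qed.

Lemma rim_mod i m a : rim i (a + m %% (3 * d i)) = rim i (a + m).
Proof. by rewrite /rim -modnDmr modn_dvdm ?dvdn_mulr // modnDmr. Qed.

Lemma disc_mod i m a : disc i (a + m %% (3 * d i)) = disc i (a + m).
Proof. by rewrite /disc modnDmr. Qed.

Lemma disc_tagged u : disc (tag u) (nat_of_ord (tagged u)) = Some (inr u).
Proof.
rewrite /disc modn_small // insubT //= => lt_u; congr (Some (inr _)).
by case: u lt_u => i m lt_m; congr (Tagged _ _); apply: val_inj.
Qed.

Lemma moore_rim i m : exists j, moore j = [set rim i m; rim i m.+1].
Proof.
exists (Some (inl (i, Ordinal (ltn_pmod m (isT : 0 < 3)%N)))) => /=.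
by rewrite -{1}[(m %% 3)%N]add0n -[(m %% 3).+1]add1n !rim_mod3.
Qed.

Lemma moore_disc i m : (0 < d i)%N ->
  [/\ exists j, moore j = [set disc i m; disc i m.+1; rim i m],
      exists j, moore j = [set disc i m.+1; rim i m; rim i m.+1] &
      exists j, moore j = [set disc i 0; disc i m; disc i m.+1]].
Proof.
move=> di; have N0 : (0 < 3 * d i)%N by rewrite muln_gt0.
pose u := Tagged (fun i => 'I_(3 * d i)) (Ordinal (ltn_pmod m N0)).
pose j e := Some (inr (u, e)) : moore_face.
have e0 := (rim_mod i m 0, rim_mod i m 1, disc_mod i m 0, disc_mod i m 1).
rewrite ?add0n ?add1n in e0.
by split; [exists (j (inord 0))|exists (j (inord 1))|exists (j (inord 2))];
  rewrite /= inordK // !e0.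
Qed.

Lemma moore_neq0 j : moore j != set0.
Proof.
case: j => [[[i m]|[u e]]|] /=; last by apply/set0Pn; exists None; rewrite inE.
  by apply/set0Pn; exists (rim i m); rewrite !inE eqxx.
case: (nat_of_ord e) => [|[|a]].
- by apply/set0Pn; exists (rim (tag u) (nat_of_ord (tagged u))); rewrite !inE eqxx !orbT.
- by apply/set0Pn; exists (rim (tag u) (nat_of_ord (tagged u))); rewrite !inE eqxx !orbT.
by apply/set0Pn; exists (disc (tag u) 0); rewrite !inE eqxx.
Qed.

Lemma cards3_le (T : finType) (x y z : T) : (#|[set x; y; z]| <= 3)%N.
Proof.
by rewrite -setUA !cardsU1 cards1; case: (_ \notin _); case: (_ \notin _).
Qed.

Lemma cards2_le (T : finType) (x y : T) : (#|[set x; y]| <= 2)%N.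
Proof. by rewrite cards2; case: (_ != _). Qed.

Lemma moore_card j : (#|moore j| <= 3)%N.
Proof.
case: j => [[[i m]|[u e]]|] /=; last by rewrite cards1.
  exact: leq_trans (cards2_le _ _) _.
by case: (nat_of_ord e) => [|[|a]]; exact: cards3_le.
Qed.

Lemma moore_connected x : connect
  (fun x y => [exists j, (x \in moore j) && (y \in moore j)]) None x.
Proof.
set adj := fun x y => _.
have adjI j y z : y \in moore j -> z \in moore j -> connect adj y z.
  by move=> yj zj; apply/connect1/existsP; exists j; rewrite yj zj.
have rimP i m : connect adj None (rim i m).
  have [j0 e0] := moore_rim i 0; have [j2 e2] := moore_rim i 2.
  have rim1 : connect adj None (rim i 1).
    by apply: (adjI j0); rewrite e0 !inE ?eqxx ?orbT.
  have rim2 : connect adj None (rim i 2).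
    by apply: (adjI j2); rewrite e2 !inE ?eqxx ?orbT.
  move: rim1 rim2; rewrite /rim /=.
  case: (m %% 3)%N (ltn_pmod m (isT : 0 < 3)%N) => [|[|[|]]] //.
case: x => [[[i b]|u]|]; last exact: connect0.
  by have := rimP i (if b then 2 else 1); case: b.
apply: connect_trans (rimP (tag u) (nat_of_ord (tagged u))) _; rewrite -disc_tagged.
have di : (0 < d (tag u))%N by have := ltn_ord (tagged u); lia.
have [[j e] _ _] := moore_disc (nat_of_ord (tagged u)) di.
by apply: (adjI j); rewrite e !inE eqxx ?orbT.
Qed.

(** * The winding cocycle *)

Definition slot i (x : moore_vertex) : option nat :=
  match x with
  | None => Some 0%N
  | Some (inl (i', b)) => if i' == i then Some b.+1 else None
  | _ => None
  end.

Definition level i (x : moore_vertex) : option nat :=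
  if x is Some (inr u) then if tag u == i then Some (nat_of_ord (tagged u)) else None
  else None.

(* A cocycle modulo [d i] with value 1 on the [i]-th loop: it vanishes on the edges
   between disc vertices, and on an edge from [disc i m] to the rim it counts the
   turns around the circle completed at [m], up to an additive constant. *)
Definition winding i x y : int :=
  match level i x, slot i x, level i y, slot i y with
  | Some m, _, _, Some s => ((m + 4 - s) %/ 3)%N%:Z
  | _, Some s, Some m, _ => - ((m + 4 - s) %/ 3)%N%:Z
  | _, Some 0%N, _, Some 2 => -1
  | _, Some 2, _, Some 0%N => 1
  | _, _, _, _ => 0
  end.

Lemma windingC i x y : winding i y x = - winding i x y.
Proof.
rewrite /winding.
by case: x => [[[i1 [] ]|u]|]; case: y => [[[i2 [] ]|w]|] //=;
  repeat (case: ifP => _ /=); rewrite ?oppr0 ?opprK.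
Qed.

Lemma slot_rim i m : slot i (rim i m) = Some (m %% 3)%N.
Proof.
rewrite /rim; case: (m %% 3)%N (ltn_pmod m (isT : 0 < 3)%N) => [|[|[|]]] //= _;
by rewrite eqxx.
Qed.

Lemma level_rim i i' m : level i (rim i' m) = None.
Proof. by rewrite /rim; case: (m %% 3)%N => [|[|]]. Qed.

Lemma slot_disc i i' m : (0 < d i')%N -> slot i (disc i' m) = None.
Proof. by move=> di; rewrite /disc insubT // ltn_pmod // muln_gt0. Qed.

Lemma level_disc i m : (0 < d i)%N -> level i (disc i m) = Some (m %% (3 * d i))%N.
Proof.
move=> di; rewrite /disc insubT ?ltn_pmod ?muln_gt0 //= => _; by rewrite eqxx.
Qed.

Lemma level_disc_neq i i' m : i' != i -> level i (disc i' m) = None.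
Proof. by move=> ii'; rewrite /disc; case: insub => //= u; rewrite (negPf ii'). Qed.

Lemma winding_neq i i' m k : i' != i -> (0 < d i')%N ->
  [/\ winding i (rim i' m) (rim i' k) = 0,
      winding i (disc i' m) (rim i' k) = 0 &
      winding i (disc i' m) (disc i' k) = 0].
Proof.
move=> ii' di; rewrite /winding !level_rim !level_disc_neq // !slot_disc //; split=> //.
rewrite /rim; case: (m %% 3)%N => [|[|a]]; case: (k %% 3)%N => [|[|b]] /=;
by rewrite ?(negPf ii').
Qed.

Lemma winding_disc_rim i m k : (0 < d i)%N ->
  winding i (disc i m) (rim i k) = ((m %% (3 * d i) + 4 - k %% 3) %/ 3)%N%:Z.
Proof.
by move=> di; rewrite /winding level_disc // slot_rim slot_disc // level_rim.
Qed.

Lemma winding_disc_disc i m k : (0 < d i)%N -> winding i (disc i m) (disc i k) = 0.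
Proof. by move=> di; rewrite /winding !level_disc // !slot_disc. Qed.

Lemma winding_rim i m : winding i (rim i m) (rim i m.+1) = (m %% 3 == 2)%N%:Z.
Proof.
rewrite /winding !level_rim !slot_rim -[m.+1]addn1 -modnDml.
by case: (m %% 3)%N (ltn_pmod m (isT : 0 < 3)%N) => [|[|[|]]].
Qed.

(** Both disc vertices give [m %/ 3 + 1] towards [rim i m], except when [m.+1 = 3 * d i]: there the
    index returns to 0 and the sum is [- d i]. *)
Lemma winding_disc1 i m : (0 < d i)%N -> (m < 3 * d i)%N ->
  ((d i)%:Z %| winding i (disc i m) (disc i m.+1) +
     winding i (disc i m.+1) (rim i m) - winding i (disc i m) (rim i m))%Z.
Proof.
move=> di lt_m; rewrite winding_disc_disc // !winding_disc_rim // (modn_small lt_m).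
have [e|ne] := eqVneq m.+1 (3 * d i)%N.
  rewrite e modnn; apply/dvdzP; exists (-1); lia.
rewrite modn_small; last by lia.
set x := (X in (_ %| X)%Z); suff -> : x = 0 by exact: dvdz0.
by rewrite /x; lia.
Qed.

(** The sum vanishes, even where the index returns to 0: passing from [rim i m] to [rim i m.+1]
    raises the count by 1 exactly when the latter is the base point. *)
Lemma winding_disc2 i m : (0 < d i)%N -> (m < 3 * d i)%N ->
  ((d i)%:Z %| winding i (disc i m.+1) (rim i m) +
     winding i (rim i m) (rim i m.+1) - winding i (disc i m.+1) (rim i m.+1))%Z.
Proof.
move=> di lt_m; rewrite winding_rim !winding_disc_rim //.
set x := (X in (_ %| X)%Z); suff -> : x = 0 by exact: dvdz0.
rewrite /x; have [e|ne] := eqVneq m.+1 (3 * d i)%N.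
  rewrite e modnn; case: eqP; lia.
by rewrite (@modn_small m.+1); [case: eqP; lia | lia].
Qed.

(** On the discs of the other circles every value is 0; on the fan triangles too, since they join
    disc vertices only. *)
Lemma winding_moore i j : (#|moore j| <= 2)%N \/ exists x y z, moore j = [set x; y; z] /\
  ((d i)%:Z %| winding i x y + winding i y z - winding i x z)%Z.
Proof.
case: j => [[[i' m]|[u e]]|] /=; [by left; exact: cards2_le|right|by left; rewrite cards1].
move: (tag u) (nat_of_ord (tagged u)) (ltn_ord (tagged u)) => i' m lt_m.
have di : (0 < d i')%N by move: lt_m; case: (d i').
have [ii'|ii'] := eqVneq i' i.
  rewrite ii' in di lt_m *; case: (nat_of_ord e) => [|[|_]].
  - exists (disc i m), (disc i m.+1), (rim i m); split=> //; exact: winding_disc1.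
  - exists (disc i m.+1), (rim i m), (rim i m.+1); split=> //; exact: winding_disc2.
  exists (disc i 0), (disc i m), (disc i m.+1); split=> //.
  by rewrite !winding_disc_disc // dvdz0.
have w m' k := winding_neq m' k ii' di.
have rr m' k : winding i (rim i' m') (rim i' k) = 0 by case: (w m' k).
have dr m' k : winding i (disc i' m') (rim i' k) = 0 by case: (w m' k).
have dd m' k : winding i (disc i' m') (disc i' k) = 0 by case: (w m' k).
case: (nat_of_ord e) => [|[|_]].
- by exists (disc i' m), (disc i' m.+1), (rim i' m); rewrite dd !dr dvdz0.
- by exists (disc i' m.+1), (rim i' m), (rim i' m.+1); rewrite rr !dr dvdz0.
by exists (disc i' 0), (disc i' m), (disc i' m.+1); rewrite !dd dvdz0.
Qed.

(** * First homology of the wedge *)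

Section Homology.
Variables (n : nat) (v : moore_vertex -> 'I_n).
Hypothesis v_inj : injective v.
Local Notation K := (down (fun j => v @: moore j)).
Local Notation edge := (edge v).

Definition loop i : exterior n := \sum_(0 <= m < 3) edge (rim i m) (rim i m.+1).

Lemma loop_chains i : loop i \in chains K 1.
Proof.
apply: rpred_sum => m _; have [j e] := moore_rim i m.
by apply: (@edge_chains _ _ v _ moore j); rewrite e !inE eqxx ?orbT.
Qed.

Lemma bd_loop i : bd (loop i) = 0.
Proof.
rewrite raddf_sum; under eq_bigr => m _ do rewrite /= bd_edge.
by rewrite telescope_sumr // subrr.
Qed.

Lemma loop_mulrn i k : loop i *+ k = \sum_(0 <= m < 3 * k) edge (rim i m) (rim i m.+1).
Proof.
elim: k => [|k IHk]; first by rewrite muln0 big_nil.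
have e a : rim i (3 * k + a) = rim i a by rewrite /rim mulnC modnMDl.
rewrite mulrSr IHk (_ : 3 * k.+1 = (3 * k).+3)%N; last by lia.
rewrite !big_nat_recr //=; set S := \sum_(0 <= m < 3 * k) _.
rewrite /loop !big_nat_recr //= big_geq // add0r !addrA.
have := (e 0%N, e 1%N, e 2%N, e 3%N); rewrite addn0 addn1 addn2 addn3.
by case=> [[[-> ->] ->] ->].
Qed.

(** Modulo boundaries, the edge from [rim i m] to [rim i m.+1] is [h m - h m.+1], where [h m] goes
    from [rim i m] to [disc i 0] through [disc i m]. The sum over [3 * d i] steps telescopes to 0 as
    [h] is periodic. *)
Lemma loop_boundaries i : loop i *+ d i \in boundaries K 1.
Proof.
rewrite loop_mulrn; have [->|] := posnP (d i); first by rewrite muln0 big_nil rpred0.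
move=> di; set N := (3 * d i)%N.
have periodic m : disc i (N + m) = disc i m /\ rim i (N + m) = rim i m.
  by split; [rewrite /disc modnDl | rewrite /rim -modnDml /N modnMr].
pose h m := edge (rim i m) (disc i m) - edge (disc i 0) (disc i m).
have cell m : edge (rim i m) (rim i m.+1) - (h m - h m.+1) \in boundaries K 1.
  have [[j1 e1] [j2 e2] [j3 e3]] := moore_disc m di.
  have t1 := @triangle_boundaries _ _ v _ moore j1 (rim i m) (disc i m) (disc i m.+1).
  have t2 := @triangle_boundaries _ _ v _ moore j2 (rim i m) (rim i m.+1) (disc i m.+1).
  have t3 := @triangle_boundaries _ _ v _ moore j3 (disc i 0) (disc i m) (disc i m.+1).
  rewrite e1 e2 e3 !inE !eqxx ?orbT in t1 t2 t3.
  have tri := rpredD (rpredB (t2 isT isT isT) (t1 isT isT isT)) (t3 isT isT isT).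
  refine (eq_ind _ (fun c => c \in boundaries K 1) tri _ _).
  rewrite /h; apply/ffunP => s; rewrite !ffunE; ring.
have -> : \sum_(0 <= m < N) edge (rim i m) (rim i m.+1) =
  \sum_(0 <= m < N) (edge (rim i m) (rim i m.+1) - (h m - h m.+1)).
  rewrite sumrB; suff -> : \sum_(0 <= m < N) (h m - h m.+1) = 0 by rewrite subr0.
  under eq_bigr => m _ do rewrite -opprB; rewrite sumrN telescope_sumr // /h.
  by have [] := periodic 0%N; rewrite addn0 => -> ->; rewrite subrr oppr0.
by apply: rpred_sum => m _.
Qed.

(** A path from the base point to [x], as [cycle_span] requires; a disc vertex is reached through
    the rim vertex of the same index. *)
Definition spoke (x : moore_vertex) : exterior n :=
  if x is Some (inr u) then
    edge None (rim (tag u) (nat_of_ord (tagged u))) +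
    edge (rim (tag u) (nat_of_ord (tagged u))) x
  else edge None x.

Lemma spoke_rim i m : spoke (rim i m) = edge None (rim i m).
Proof. by rewrite /rim; case: (m %% 3)%N => [|[|]]. Qed.

Lemma spoke_disc i m : (0 < d i)%N ->
  spoke (disc i m) = edge None (rim i m) + edge (rim i m) (disc i m).
Proof.
move=> di; have N0 : (0 < 3 * d i)%N by rewrite muln_gt0.
pose u := Tagged (fun i => 'I_(3 * d i)) (Ordinal (ltn_pmod m N0)).
have e0 := (rim_mod i m 0, disc_mod i m 0); rewrite !add0n in e0.
have := disc_tagged u; rewrite /= e0 => {1}->.
by rewrite /spoke /= e0 -(disc_tagged u) /= e0.
Qed.

Definition loops (a : 'rV[int]_q) : exterior n := \sum_i loop i *~ a 0 i.

Fact loops_is_zmod_morphism : zmod_morphism loops.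
Proof.
by move=> a b; rewrite /loops -sumrB; apply: eq_bigr => i _; rewrite !mxE mulrzBr.
Qed.
HB.instance Definition _ := GRing.isZmodMorphism.Build 'rV[int]_q (exterior n)
  loops loops_is_zmod_morphism.

Lemma loops_delta i : loops (delta_mx 0 i) = loop i.
Proof.
rewrite /loops (bigD1 i) //= mxE !eqxx mulr1z big1 ?addr0 // => j ji.
by rewrite mxE (negPf ji) andbF mulr0z.
Qed.

(* The edge from [x] to [y], closed up through the base point, is homologous to a
   combination of loops; [deck] passes to the third side of a triangle. *)
Let deck (x y : moore_vertex) :=
  exists a, spoke x + edge x y - spoke y - loops a \in boundaries K 1.

Let deck0 x y : spoke x + edge x y - spoke y = 0 -> deck x y.
Proof. by move=> e; exists 0; rewrite e raddf0 subr0 rpred0. Qed.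

Let deck_sym x y : deck x y -> deck y x.
Proof.
case=> a ea; exists (- a); rewrite -rpredN.
refine (eq_ind _ (fun c => c \in boundaries K 1) ea _ _).
rewrite edgeC (raddfN loops); apply/ffunP => s; rewrite !ffunE; ring.
Qed.

Let deck_trans j x y z : x \in moore j -> y \in moore j -> z \in moore j ->
  deck x y -> deck y z -> deck x z.
Proof.
move=> xj yj zj [a ea] [b eb]; exists (a + b).
have tri := triangle_boundaries v xj yj zj.
refine (eq_ind _ (fun c => c \in boundaries K 1) (rpredB (rpredD ea eb) tri) _ _).
rewrite (raddfD loops); apply/ffunP => s; rewrite !ffunE; ring.
Qed.

Let deckxx x : deck x x.
Proof. by apply: deck0; rewrite edgexx addr0 subrr. Qed.

Let deck_face j x y z : moore j = [set x; y; z] -> deck x y -> deck y z ->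
  forall x' y', x' \in moore j -> y' \in moore j -> deck x' y'.
Proof.
move=> e xy yz; have xz : deck x z.
  by apply: (deck_trans (j := j)) xy yz; rewrite e !inE eqxx ?orbT.
have [[yx zy] zx] := (deck_sym xy, deck_sym yz, deck_sym xz).
move=> x' y'; rewrite e !inE -!orbA.
by case/or3P => /eqP->; case/or3P => /eqP->.
Qed.

(** The two edges at the base point are spokes and close up to 0; the remaining edge, with
    [m %% 3 = 1], closes up to the loop. *)
Let deck_rim i m : deck (rim i m) (rim i m.+1).
Proof.
have [a ea] : exists a, spoke (rim i m) + edge (rim i m) (rim i m.+1) -
    spoke (rim i m.+1) = loops a.
  rewrite !spoke_rim -[m.+1]addn1 /rim -(modnDml m 1).
  case: (m %% 3)%N (ltn_pmod m (isT : 0 < 3)%N) => [|[|[|]]] //= _.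
  - by exists 0; rewrite edgexx raddf0 add0r subrr.
  - exists (delta_mx 0 i); rewrite loops_delta /loop !big_nat_recr //= big_geq //.
    by rewrite add0r /rim /= [edge (Some (inl (i, true))) None]edgeC.
  by exists 0; rewrite raddf0 edgexx subr0 [X in _ + X]edgeC subrr.
by exists a; rewrite ea subrr rpred0.
Qed.

Let deck_rim_disc i m : (0 < d i)%N -> deck (rim i m) (disc i m).
Proof. by move=> di; apply: deck0; rewrite spoke_rim spoke_disc // subrr. Qed.

Let deck_rim_discS i m : (0 < d i)%N -> deck (rim i m) (disc i m.+1).
Proof.
move=> di; have [_ [j e] _] := moore_disc m di.
by apply: (deck_trans (j := j)) (deck_rim i m) (deck_rim_disc m.+1 di);
  rewrite e !inE eqxx ?orbT.
Qed.

Let deck_disc i m : (0 < d i)%N -> deck (disc i m) (disc i m.+1).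
Proof.
move=> di; have [[j e] _ _] := moore_disc m di.
by apply: (deck_trans (j := j)) (deck_sym (deck_rim_disc m di)) (deck_rim_discS m di);
  rewrite e !inE eqxx ?orbT.
Qed.

Let deck_disc0 i m : (0 < d i)%N -> deck (disc i 0) (disc i m).
Proof.
move=> di; elim: m => [|m IHm]; first exact: deckxx.
have [_ _ [j e]] := moore_disc m di.
by apply: (deck_trans (j := j)) IHm (deck_disc m di); rewrite e !inE eqxx ?orbT.
Qed.

Let deck_moore x y j : x \in moore j -> y \in moore j -> deck x y.
Proof.
move: x y; case: j => [[[i m]|[u e]]|].
- move=> x y /=; rewrite !inE => /orP[] /eqP-> /orP[] /eqP->.
  + exact: deckxx.
  + exact: deck_rim.
  + exact/deck_sym/deck_rim.
  exact: deckxx.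
- have di : (0 < d (tag u))%N by have := ltn_ord (tagged u); lia.
  move: (erefl (moore (Some (inr (u, e))))); rewrite {1}/moore.
  case: (nat_of_ord e) => [|[|a]] /esym E; apply: (deck_face E).
  + exact: deck_disc.
  + exact/deck_sym/deck_rim_discS.
  + exact/deck_sym/deck_rim_discS.
  + exact: deck_rim.
  + exact: deck_disc0.
  exact: deck_disc.
by move=> x y; rewrite !inE => /eqP-> /eqP->; exact: deckxx.
Qed.

(** The winding cocycle sends [loop j] to 1 if [j = i] and to 0 otherwise, so it reads off the
    coordinate [a 0 i] modulo [d i]; conversely [loop_boundaries] kills the multiples of [d i]. *)
Lemma presents_moore :
  presents K 1 (fun a : 'rV[int]_q => forall i : 'I_q, ((d i)%:Z %| a 0%R i)%Z).
Proof.
exists loops; split.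
- move=> a; split; first by apply: rpred_sum => i _; rewrite rpredMz ?loop_chains.
  by rewrite raddf_sum big1 // => i _; rewrite raddfMz /= bd_loop mul0rz.
- by apply: cycle_span => // x y j; exact: deck_moore.
move=> a; split=> [la i|da].
  have [Theta [ThetaE Theta_dvd]] :=
    cocycle_boundaries v_inj (@windingC i) (winding_moore i).
  suff -> : a 0 i = Theta (loops a) by exact: Theta_dvd.
  have Theta_loop j : Theta (loop j) = (j == i)%:Z.
    rewrite /loop !big_nat_recr //= big_geq // add0r !raddfD /= !ThetaE.
    have [->|ji] := eqVneq j i; first by rewrite !winding_rim.
    by rewrite /winding !level_rim /rim /= (negPf ji).
  rewrite raddf_sum (bigD1 i) //= raddfMz Theta_loop eqxx intz big1 ?addr0 // => j ji.
  by rewrite raddfMz Theta_loop (negPf ji) mul0rz.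
apply: rpred_sum => i _; have /dvdzP[b ->] := da i.
by rewrite mulrC mulrzA rpredMz // loop_boundaries.
Qed.

End Homology.
End MooreComplex.

(** * Minimal connected covers *)

Section GeneratedCover.
Variables (n r : nat) (J : finType) (F : J -> {set 'I_n}).
Hypothesis F_cover : forall i, exists j, i \in F j.

Definition generated_simplices : {set {set 'I_n}} := [set s | (s != set0) && down F s].

Fact generated_neq0 : set0 \notin generated_simplices.
Proof. by rewrite inE eqxx. Qed.

Fact generated1 i : [set i] \in generated_simplices.
Proof.
have [j ij] := F_cover i; rewrite inE -card_gt0 cards1; apply/existsP; exists j.
by rewrite sub1set.
Qed.

Fact generatedS (s t : {set 'I_n}) : s \in generated_simplices ->
  t \subset s -> t != set0 -> t \in generated_simplices.
Proof. by rewrite !inE => /andP[_ sF] ts ->; exact: down_sub sF. Qed.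

Definition generated := Complex generated_neq0 generated1 generatedS.

Implicit Types (s t : {set 'I_n}).
Hypothesis r_gt0 : (0 < r)%N.
Hypothesis F_card : forall j, #|F j| = r.+1.
Hypothesis F_private : forall j, exists2 x, x \in F j & forall j', x \in F j' -> j' = j.
Hypothesis F_connected :
  exists o, forall x, connect (fun x y => [exists j, (x \in F j) && (y \in F j)]) o x.

Let F_neq0 j : F j != set0.
Proof. by rewrite -card_gt0 F_card. Qed.

Let mem_generated s j : s \subset F j -> s != set0 -> s \in generated.
Proof. by move=> sj s0; rewrite inE s0; apply/existsP; exists j. Qed.

Let facets_generated s : (s \in facets generated) = [exists j, s == F j].
Proof.
rewrite 2!inE -andbA; apply/and4P/existsP => [[s0 /existsP[j sj] _ s_max]|[j /eqP->]].
  exists j; apply: contraR s_max => ne; apply/exists_inP; exists (F j).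
    exact: mem_generated (subxx _) _.
  by rewrite properEneq ne.
split; first exact: F_neq0; first by apply/existsP; exists j.
  by rewrite F_card ltnS.
apply/exists_inP => -[t]; rewrite inE => /andP[_ /existsP[j' tj']] /proper_card.
by rewrite F_card => lt_t; have := subset_leq_card tj'; rewrite F_card leqNgt lt_t.
Qed.

(** As the generators have equal cardinality, they are the facets. The private vertex of [F j]
    becomes isolated once [F j] is removed, while [0 < r] provides a second vertex. *)
Lemma generated_minimal_cover : minimal_connected_cover r generated.
Proof.
have adjC : connect_sym (adjacent generated).
  by apply: sym_connect_sym => x y; rewrite /adjacent setUC.
have [o o_conn] := F_connected.
apply/and3P; split.
- apply/andP; split; last first.
    apply/forall_inP => s; rewrite facets_generated => /existsP[j /eqP->].
    by rewrite F_card.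
  (* The vertex [o] lies in some generator, so the maximum [r.+1] is attained. *)
  have [j _] := F_cover o; rewrite /dim -[r]/(r.+1.-1) eq_sym; apply/eqP; congr _.-1.
  apply/eqP; rewrite eqn_leq; apply/andP; split.
    by rewrite -(F_card j); apply: leq_bigmax_cond; exact: mem_generated (subxx _) _.
  apply/bigmax_leqP => s; rewrite inE => /andP[_ /existsP[j' sj']].
  by rewrite -(F_card j') subset_leq_card.
- have o_adj x : connect (adjacent generated) o x.
    apply: connect_sub (o_conn x) => y z /existsP[j /andP[yj zj]]; apply: connect1.
    apply: (@mem_generated _ j); first by rewrite subUset !sub1set yj.
    by apply/set0Pn; exists y; rewrite !inE eqxx.
  apply/forallP => x; apply/forallP => y; apply: connect_trans (o_adj y).
  by rewrite adjC.
apply/forall_inP => s; rewrite facets_generated => /existsP[j /eqP->].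
have [x xj x_priv] := F_private j.
have /set0Pn[y] : F j :\ x != set0.
  by rewrite -card_gt0; have := F_card j; rewrite (cardsD1 x) xj add1n => -[->].
rewrite !inE => /andP[yx yj]; apply/negP => /forallP/(_ x)/forallP/(_ y).
have isolated z : adjacent (remove_facet generated (F j)) x z -> z = x.
  rewrite /adjacent inE => /andP[_ /orP[|/exists_inP[u]]].
    by rewrite cards2 eqSS eqb0 negbK => /eqP->.
  rewrite in_setD1 facets_generated => /andP[u_j /existsP[j' /eqP uE]].
  rewrite uE subUset !sub1set => /andP[/x_priv jj' _].
  by rewrite uE jj' eqxx in u_j.
case/connectP => p; elim: p => [_ /= e|z p IHp /=]; first by rewrite e eqxx in yx.
by case/andP => /isolated ->.
Qed.
End GeneratedCover.

(** Chains of dimension [k] live on sets of cardinality [k.+1], so [set0] never occurs in them. *)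
Lemma presents_ext n (K K' : pred {set 'I_n}) k q Z :
  (forall s, s != set0 -> K s = K' s) -> @presents n K k q Z -> presents K' k Z.
Proof.
move=> KK'; have E : chains K = chains K'.
  apply/funext => m; rewrite /chains; congr support; apply/funext => s.
  by have [->|/KK'->//] := eqVneq s set0; rewrite cards0 !andbF.
by rewrite /presents /boundaries E.
Qed.

(** * Diagonal presentations from the Smith normal form *)

Lemma finitely_presented_diagonal (G : zmodType) : finitely_presented G ->
  exists q (d : 'I_q -> nat) (f : {additive 'rV[int]_q -> G}),
    (forall x, exists v, f v = x) /\
    (forall v, f v = 0 <-> forall i, ((d i)%:Z %| v 0%R i)%Z).
Proof.
move=> [p [q [A [f [f_surj f_ker]]]]].
have [L Lu [R Ru [e _ AE]]] := int_Smith_normal_form A.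
(* A coordinate past the [p] rows is subject to no relation; divisor 0 makes the corresponding
   generator free. *)
pose d (i : 'I_q) := if (i < p)%N then `|(e`_i)%R|%N else 0%N.
(* Precomposing with [R] changes the generators so that the relations become the rows of the
   diagonal matrix; the invertible [L] only recombines them. *)
pose g v := f (v *m R).
have gB : zmod_morphism g by move=> u v; rewrite /g mulmxBl raddfB.
pose gA := GRing.isZmodMorphism.Build _ _ g gB.
exists q, d, (HB.pack_for {additive 'rV[int]_q -> G} g gA); split=> [x|v].
  by have [v <-] := f_surj x; exists (v *m invmx R); rewrite /= /g mulmxKV.
rewrite /= /g f_ker.
have diagE (w : 'rV_p) i :
    (w *m \matrix_(i < p, j < q) (e`_i *+ (i == j :> nat))) 0 i =
    if insub (nat_of_ord i) is Some i' then w 0 i' * e`_i else 0.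
  rewrite mxE; case: insubP => [i' _ i'i|iNp].
    rewrite (bigD1 i') //= mxE i'i eqxx mulr1n big1 ?addr0 // => j ji.
    rewrite mxE -i'i; case: eqP => [/val_inj ji'|]; last by rewrite mulr0.
    by rewrite ji' eqxx in ji.
  rewrite big1 // => j _; rewrite mxE; case: eqP => [ji|]; last by rewrite mulr0.
  by case/negP: iNp; rewrite -ji.
split=> [[w e_w]|dv].
  have {}e_w : v = (w *m L) *m \matrix_(i < p, j < q) (e`_i *+ (i == j :> nat)).
    by rewrite -[v](mulmxK Ru) e_w AE !mulmxA mulmxK.
  move=> i; rewrite e_w diagE /d; case: insubP => [i' -> _|/negPf->]; last exact: dvdz0.
  by rewrite dvdzE /= abszM dvdn_mull.
pose w : 'rV_p := \row_(i < p) if (insub (nat_of_ord i) : option 'I_q) is Some j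
  then (v 0%R j %/ (e`_i)%R)%Z else 0.
exists (w *m invmx L); rewrite AE !mulmxA mulmxKV //; congr (_ *m _).
apply/rowP => i; rewrite diagE; have := dv i; rewrite /d.
case: insubP => [i' -> i'i|/negPf->]; last by rewrite dvd0z => /eqP.
rewrite mxE i'i valK dvdzE /= => dvd.
by rewrite divzK.
Qed.

(* Quantifying over all embeddings [v] leaves room for the vertices added later
   and makes the order of the vertices irrelevant. *)
Definition realizable k q (Z : 'rV[int]_q -> Prop) :=
  exists (T J : finType) (core : J -> {set T}),
  [/\ forall j, (0 < #|core j| <= k.+2)%N,
      forall x, exists j, x \in core j,
      exists o, forall x,
        connect (fun x y => [exists j, (x \in core j) && (y \in core j)]) o x &
      forall n (v : T -> 'I_n), injective v ->
        presents (down (fun j => v @: core j)) k Z].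

(** * Realization in every degree, then by a minimal cover *)

Lemma realizable_moore q (d : 'I_q -> nat) :
  realizable 1 (fun a : 'rV[int]_q => forall i : 'I_q, ((d i)%:Z %| a 0%R i)%Z).
Proof.
exists (moore_vertex d), (moore_face d), (@moore q d); split.
- by move=> j; rewrite card_gt0 moore_neq0 moore_card.
- case=> [[[i b]|u]|]; last by exists None; rewrite inE.
    have [j e] := moore_rim d i (if b then 2 else 1); exists j; rewrite e.
    by case: b {e}; rewrite !inE eqxx.
  have di : (0 < d (tag u))%N by have := ltn_ord (tagged u); lia.
  have [[j e] _ _] := moore_disc (nat_of_ord (tagged u)) di.
  by exists j; rewrite e -disc_tagged !inE eqxx.
- by exists None; exact: moore_connected.
by move=> n v v_inj; exact: presents_moore.
Qed.

(** Each core is joined to each of two new poles, which are embedded along with [T]; the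
    presentation over the old vertices comes from [v \o inl]. *)
Lemma realizable_susp k q Z : @realizable k q Z -> realizable k.+1 Z.
Proof.
move=> [T [J [core [core_card core_cover [o _] core_presents]]]].
pose core' (e : J * bool) : {set (T + bool)%type} := inr e.2 |: inl @: core e.1.
have inr_inl b (A : {set T}) : (inr b : T + bool) \notin inl @: A by apply/imsetP => -[].
have core'_inl x : exists j, forall b, (inl x \in core' (j, b)) && (inr b \in core' (j, b)).
  have [j xj] := core_cover x; exists j => b.
  by rewrite !inE /= eqxx andbT; apply: imset_f.
exists (T + bool)%type, (J * bool)%type, core'; split.
- move=> [j b]; rewrite /core' cardsU1 inr_inl card_imset; last exact: inl_inj.
  by have /andP[_] := core_card j.
- case=> [x|b].
    by have [j /(_ true)/andP[xj _]] := core'_inl x; exists (j, true).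
  by have [j /(_ b)/andP[_ bj]] := core'_inl o; exists (j, b).
- exists (inr true); set adj := fun x y => _.
  have inl_conn x b : connect adj (inr b) (inl x) && connect adj (inl x) (inr b).
    have [j /(_ b)/andP[xj bj]] := core'_inl x.
    by apply/andP; split; apply/connect1/existsP; exists (j, b); rewrite xj bj.
  case=> [x|b]; first by case/andP: (inl_conn x true).
  have [[to_o _] [_ from_o]] := (andP (inl_conn o true), andP (inl_conn o b)).
  exact: connect_trans to_o from_o.
move=> n v v_inj.
have vl_inj : injective (v \o inl) by apply: inj_comp => //; exact: inl_inj.
have vrl b x : v (inr b) != v (inl x) by rewrite (inj_eq v_inj).
have pres := presents_susp _ _ _ (core_presents n _ vl_inj).
apply: presents_ext (pres (v (inr true)) (v (inr false)) _ _ _).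
- move=> s _; rewrite /susp; apply/orP/existsP => [[]/existsP[j]|[[j b]]].
  + by rewrite subDset => sj; exists (j, true); rewrite /core' imsetU1 -imset_comp.
  + by rewrite subDset => sj; exists (j, false); rewrite /core' imsetU1 -imset_comp.
  rewrite /core' /= imsetU1 -imset_comp -subDset => sj.
  by case: b sj => sj; [left|right]; apply/existsP; exists j.
- exact: down_sub.
- move=> s /existsP[j sj]; apply/andP; split; apply/negP => /(subsetP sj)/imsetP[x _ /eqP];
  by rewrite /= (negPf (vrl _ _)).
by rewrite (inj_eq v_inj).
Qed.

Lemma realizable_minimal_cover k r q (Z : 'rV[int]_q -> Prop) :
  (k.+3 <= r)%N -> realizable k.+1 Z ->
  exists n (Y : simplicial_complex n),
    minimal_connected_cover r Y /\ presents (mem Y) k.+1 Z.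
Proof.
move=> kr [T [J [core [core_card core_cover [o core_conn] core_presents]]]].
(* A core has at most [k.+3 <= r] points, so at least one private vertex is added to reach
   [r.+1]. *)
pose m j := (r.+1 - #|core j|)%N.
pose T' : finType := (T + {j : J & 'I_(m j)})%type.
pose v : T' -> 'I_#|T'| := enum_rank.
have v_inj : injective v := enum_rank_inj.
pose free j (a : 'I_(m j)) : T' := inr (Tagged (fun j => 'I_(m j)) a).
have free_inj j : injective (@free j) by move=> a b [/eqP]; rewrite eq_Tagged => /eqP.
pose C j := (v \o inl) @: core j.
pose P j := (v \o @free j) @: [set: 'I_(m j)].
pose F j := C j :|: P j.
have vl_inj : injective (v \o inl) by apply: inj_comp => //; exact: inl_inj.
have core_le j : (#|core j| <= r)%N by have /andP[_ /leq_trans->] := core_card j.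
have CF x j : (v (inl x) \in F j) = (x \in core j).
  rewrite inE -[v (inl x)]/((v \o inl) x) mem_imset // orbC.
  by case: imsetP => // -[a _ /v_inj].
have PF j (a : 'I_(m j)) j' : (v (free j a) \in F j') = (j' == j).
  rewrite inE; have /negPf-> : v (free j a) \notin C j'.
    by apply/imsetP => -[x _ /v_inj].
  apply/imsetP/eqP => [[b _ /v_inj e]|jj']; last by rewrite jj'; exists a.
  by have := congr1 (fun x : T' => if x is inr u then tag u else j) e.
have F_card j : #|F j| = r.+1.
  rewrite cardsU (_ : C j :&: P j = set0) ?cards0 ?subn0.
    have vfree_inj : injective (v \o @free j) by exact: inj_comp.
    rewrite (card_imset _ vl_inj) (card_imset _ vfree_inj) cardsT card_ord.
    by rewrite subnKC // leqW.
  apply/setP => i; rewrite !inE; apply/andP => -[/imsetP[x _ ->] /imsetP[a _]].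
  by move=> /v_inj.
have F_private j : exists2 i, i \in F j & forall j', i \in F j' -> j' = j.
  have m0 : (0 < m j)%N by rewrite subn_gt0 ltnS.
  exists (v (free j (Ordinal m0))); first by rewrite PF.
  by move=> j'; rewrite PF => /eqP.
have vP i : exists x, i = v x by exists (enum_val i); rewrite /v enum_valK.
have F_cover i : exists j, i \in F j.
  have [[x|[j a]] ->] := vP i; first by have [j] := core_cover x; exists j; rewrite CF.
  by exists j; rewrite (PF j a).
exists #|T'|, (generated F_cover); split.
  apply: generated_minimal_cover => //; first exact: leq_trans kr.
  exists (v (inl o)).
  set adj := fun x y => _.
  have C_conn x : connect adj (v (inl o)) (v (inl x)).
    case/connectP: (core_conn x) => p e ->; elim: p (o) e => [|y p IHp] z /=.
      by rewrite connect0.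
    case/andP => /existsP[j /andP[zj yj]] /IHp; apply: connect_trans.
    by apply/connect1/existsP; exists j; rewrite !CF zj yj.
  move=> i; have [[x|[j a]] ->] := vP i; first exact: C_conn.
  have /andP[] := core_card j; rewrite card_gt0 => /set0Pn[x xj] _.
  apply: connect_trans (C_conn x) _; apply/connect1/existsP; exists j.
  by rewrite CF xj (PF j a) eqxx.
apply: (@presents_ext _ (down F)) => [s s0|]; first by rewrite /= inE s0.
(* Any point of the core can serve as the apex [b j]. *)
have b_core j : {b | b \in C j}.
  apply: sigW; have /andP[] := core_card j; rewrite card_gt0 => /set0Pn[x xj] _.
  by exists (v (inl x)); exact: (imset_f (v \o inl)).
apply: (presents_thicken (core := C) (b := fun j => sval (b_core j))).
- by move=> j; exact: subsetUl.
- by move=> j; exact: valP (b_core j).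
- move=> j j' i jj'; have [[x|[j1 a]] ->] := vP i.
    by rewrite !CF => xj _; exact: (imset_f (v \o inl)).
  by rewrite !(PF j1 a) => /eqP e /eqP e'; rewrite e e' eqxx in jj'.
exact: core_presents.
Qed.

Lemma realizable_finitely_presented (G : zmodType) k : finitely_presented G ->
  exists q (f : {additive 'rV[int]_q -> G}),
    (forall x, exists v, f v = x) /\ realizable k.+1 (fun v => f v = 0).
Proof.
move=> /finitely_presented_diagonal[q [d [f [f_surj f_ker]]]].
exists q, f; split=> //.
have -> : (fun v => f v = 0) = (fun v => forall i : 'I_q, ((d i)%:Z %| v 0%R i)%Z).
  by apply/funext => v; apply/propext; exact: f_ker.
by elim: k => [|k]; [exact: realizable_moore | exact: realizable_susp].
Qed.

Local Close Scope ring_scope.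

Theorem corollary2p9 (r : nat) (hr : 2 <= r)
    (G : zmodType) (hG : finitely_presented G)
    (k : nat) (hk1 : 1 <= k) (hkr : k <= r - 2) :
  exists (n : nat) (Y : simplicial_complex n),
    minimal_connected_cover r Y /\ isomorphic (homology Y k) G.
Proof.
case: k hk1 hkr => // k _ kr.
have [q [f [f_surj real]]] := realizable_finitely_presented k hG.
(* [k.+1 <= r - 2] amounts to [k.+3 <= r], the room needed for a private vertex in each enlarged
   core. *)
have [|n [Y [Y_cover Y_presents]]] := realizable_minimal_cover (r := r) _ real.
  by lia.
exists n, Y; split=> //; exact: isomorphic_homology f_surj Y_presents.
Qed.
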